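(* Fix $d\in\mathbb{N}$ and let $f_d:\mathbb{R}\to\mathbb{R}$ be \[ f_d(a) = \begin{cases} 1 + |a| & a \leq 0,\\ \left(\sum_{i = 0}^{d - 1} a^i\right)^{-1} & 0 \leq a \leq 1,\\ 1 + 1/d - a & 1 \leq a \leq 1 + 1/d,\\ 0 & a \geq 1 + 1/d. \end{cases} \] Fix $(a,A)\in\mathbb{R}^2$. Then: (i) If $A < f_d(a)$, then for every $\epsilon > 0$, $\mathbb{R}^d$ is uniformly $\epsilon\Psi_{a,A}$-approximable. (ii) If $A > f_d(a)$, then $\mathbb{R}^d$ is not uniformly $\kappa\Psi_{a,A}$-approximable for any $\kappa > 0$. (iii) If $A = f_d(a)$, then there exist $0 < \epsilon \leq \kappa < \infty$ such that $\mathbb{R}^d$ is uniformly $\kappa\Psi_{a,A}$-approximable but not uniformly $\epsilon\Psi_{a,A}$-approximable.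
   Context: $\|\cdot\|$ denotes the max norm on $\mathbb{R}^d$. For $\Psi:\mathbb{N}\times\mathbb{N}\to(0,\infty)$ and $Q_0\in\mathbb{N}$, a point $\mathbf{x}\in\mathbb{R}^d$ is $(\Psi,Q_0)$-approximable if for every integer $Q\geq Q_0$ there exist $\mathbf{p}\in\mathbb{Z}^d$ and an integer $1\leq q\leq Q$ with $\|\mathbf{x}-\mathbf{p}/q\| < \Psi(q,Q)$. A set $S\subseteq\mathbb{R}^d$ is uniformly $\Psi$-approximable if there is a single $Q_0\in\mathbb{N}$ such that every point of $S$ is $(\Psi,Q_0)$-approximable. For $a,A\in\mathbb{R}$, $\Psi_{a,A}(q,Q) = q^{-a}Q^{-A}$, and for a constant $c>0$, $c\Psi_{a,A}$ denotes the function $(q,Q)\mapsto c\,q^{-a}Q^{-A}$. *)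

(* Defs.v *)
From Stdlib Require Import Reals Lra Lia ZArith.
Open Scope R_scope.

(* A point of R^d is represented by x : nat -> R, only the coordinates
   0..d-1 matter.  Max norm on R^d: max_{i<d} |v i| (0 for d = 0). *)
Fixpoint maxnorm (d : nat) (v : nat -> R) : R :=
  match d with
  | O => 0
  | S k => Rmax (maxnorm k v) (Rabs (v k))
  end.

Definition approximable (d : nat) (Psi : nat -> nat -> R) (Q0 : nat)
  (x : nat -> R) : Prop :=
  forall Q : nat, (Q0 <= Q)%nat ->
    exists (p : nat -> Z) (q : nat),
      (1 <= q)%nat /\ (q <= Q)%nat /\
      maxnorm d (fun i => x i - IZR (p i) / INR q) < Psi q Q.

Definition uniformly_approximable_Rd (d : nat) (Psi : nat -> nat -> R) : Prop :=
  exists Q0 : nat, forall x : nat -> R, approximable d Psi Q0 x.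

Definition PsiaA (c a A : R) : nat -> nat -> R :=
  fun q Q => c * Rpower (INR q) (- a) * Rpower (INR Q) (- A).

Definition f_d (d : nat) (a : R) : R :=
  if Rle_dec a 0 then 1 + Rabs a
  else if Rle_dec a 1 then / sum_f_R0 (fun i => a ^ i) (d - 1)
  else if Rle_dec a (1 + / INR d) then 1 + / INR d - a
  else 0.

(* Main.v *)
(* At the critical exponent A = f_d(a) one needs both an upper and a lower
   bound valid up to constants; the cases A <> f_d(a) follow by letting Q grow.

   Lower bounds.  For a <= 0 take x = (1/(2Q), ..., 1/(2Q)).  For 0 <= a <= 1
   induct on d: a last coordinate 1/(2Q) keeps every p/q with q <= Q at distance
   at least 1/(2Q), and the other coordinates are bad for d - 1 up to height
   Q^(1/(a + f_(d-1)(a))).  For a >= 1 take the badly approximable vector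
   (alpha^-1, ..., alpha^-d) with alpha^(d+1) = 2: if p/q is close to it, the
   norm of q + p_1 alpha + ... + p_d alpha^d is a nonzero integer of size
   O(q |qx - p|^d).

   Upper bounds.  For 0 <= a let (q_i, p_i) realise (up to a factor 2) the
   successive minima of e = |qx - p| over 1 <= q <= Q.  A pigeonhole on the
   points qx mod 1, with boxes skewed along the flag spanned by these vectors,
   gives e_1 ... e_d <= C/Q.  For any subset S of them integrality of a
   determinant gives 1 <= (d+1)! q_j prod_(S - j) e_i for some j in S.  If no p/q
   is good enough, then e_j >= kappa q_j^(1-a) Q^-A, so that
   prod_S e_i >= (kappa/(d+1)!) (prod_(S - j) e_i)^a Q^-A, and by induction
   e_1 ... e_d >= (kappa/(d+1)!) Q^(-A(1 + a + ... + a^(d-1))), which for large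
   kappa contradicts the upper bound C/Q.  For a >= 1 the same product bound is
   Dirichlet's theorem. *)

Require Import Defs.
From Stdlib Require Import Reals Lra Lia ZArith Classical.
From mathcomp Require all_boot all_order all_algebra all_fingroup ring lra zify Rstruct.
Open Scope R_scope.

(* The MathComp imports are confined to a module: they would change the meaning
   of the notations of nat_scope in the statement of the theorem. *)
Module GeometryOfNumbers.
Import all_boot all_order all_algebra all_fingroup.
Import mathcomp.algebra_tactics.ring mathcomp.algebra_tactics.lra mathcomp.zify.zify Rstruct.
Import Order.TTheory GRing.Theory Num.Theory.
Set Implicit Arguments.
Unset Strict Implicit.
Unset Printing Implicit Defensive.
Local Open Scope ring_scope.

(** * Linear functionals adapted to a flag *)

Section SupNorm.
Variables (R : archiRealFieldType) (d : nat).
Implicit Types (z : 'rV[R]_d).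

Definition supn z : R := \big[Num.max/0]_(i < d) `|z 0 i|.

Lemma supn_leP z b : reflect (0 <= b /\ forall i, `|z 0 i| <= b) (supn z <= b).
Proof.
by apply: (iffP (bigmax_leP _ _ _ _)) => -[b0 h]; split=> // i *; apply: h.
Qed.

Lemma supn_ge0 z : 0 <= supn z.
Proof. by have /supn_leP[] := lexx (supn z). Qed.

Lemma le_supn z i : `|z 0 i| <= supn z.
Proof. by have /supn_leP[_] := lexx (supn z). Qed.

Lemma supnD z1 z2 : supn (z1 + z2) <= supn z1 + supn z2.
Proof.
apply/supn_leP; split=> [|i]; first by rewrite addr_ge0 ?supn_ge0.
by rewrite mxE (le_trans (ler_normD _ _)) // lerD ?le_supn.
Qed.

Lemma supnZ_le c z : supn (c *: z) <= `|c| * supn z.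
Proof.
apply/supn_leP; split=> [|i]; first by rewrite mulr_ge0 ?supn_ge0.
by rewrite mxE normrM ler_wpM2l ?le_supn.
Qed.

Lemma supn0 : supn 0 = 0.
Proof.
apply/le_anti; rewrite supn_ge0 andbT; apply/supn_leP; split=> // i.
by rewrite mxE normr0.
Qed.
End SupNorm.

Lemma normMmx_le (R : archiRealFieldType) m n (z : 'rV[R]_m) (M : 'M[R]_(m, n)) j :
  `|(z *m M) 0 j| <= supn z * \sum_i `|M i j|.
Proof.
rewrite mxE mulr_sumr (le_trans (ler_norm_sum _ _ _)) // ler_sum // => i _.
by rewrite normrM ler_wpM2r ?le_supn.
Qed.

(* Gaussian elimination with partial pivoting on the columns: after step k the
   residual map P kills y_0, ..., y_(k-1) and has its image supported in J. *)
Lemma flag_functionals_aux (R : archiRealFieldType) d (y : nat -> 'rV[R]_d) k :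
  (k <= d)%N ->
  exists (u : nat -> 'cV[R]_d) (P : 'M[R]_d) (J : {set 'I_d}),
  [/\ #|J| = (d - k)%N,
      forall (z : 'rV_d) j, j \notin J -> (z *m P) 0 j = 0,
      forall l, (l < k)%N -> y l *m P = 0,
      forall z, supn (z *m P) <= 2 ^+ k * supn z
    & [/\ forall (z : 'rV_d) i, (i < k)%N -> `|(z *m u i) 0 0| <= 2 ^+ k * supn z,
      forall l i, (l < i)%N -> (i < k)%N -> (y l *m u i) 0 0 = 0
    & forall (z : 'rV_d) (b : R), (forall i, (i < k)%N -> `|(z *m u i) 0 0| <= b) ->
        supn z <= b *+ k + supn (z *m P)]].
Proof.
elim: k => [_|k IHk ltkd].
  exists (fun=> 0), 1%:M, [set: 'I_d]; split=> //.
  - by rewrite cardsT card_ord subn0.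
  - by move=> z j; rewrite inE.
  - by move=> z; rewrite mulmx1 expr0 mul1r.
  - by split=> // z b _; rewrite mulr0n add0r mulmx1.
have [u [P [J [cardJ suppP killP boundP [boundu killu recu]]]]] := IHk (ltnW ltkd).
have [j0 j0J] : exists j0, j0 \in J by apply/set0Pn; rewrite -card_gt0 cardJ subn_gt0.
pose w := y k *m P.
(* The pivot row is the residual of [y k] divided by its entry of largest absolute value, so that
   elimination with it at most doubles norms. If that residual is zero, any index of [J] serves as
   pivot. *)
have [j [r [jJ r1 rle rJ rw]]] : exists (j : 'I_d) (r : 'rV[R]_d),
    [/\ j \in J, r 0 j = 1, supn r <= 1, forall i, i \notin J -> r 0 i = 0
      & w = w 0 j *: r].
  have [w0|wN0] := eqVneq w 0.
    exists j0, (delta_mx 0 j0); split=> //.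
    - by rewrite mxE !eqxx.
    - apply/supn_leP; split=> // i; rewrite mxE eqxx /=.
      by case: eqP; rewrite ?normr1 ?normr0.
    - move=> i iJ; rewrite mxE eqxx /=.
      by case: eqP iJ => // ->; rewrite j0J.
    - by rewrite w0 mxE scale0r.
  pose j := [arg max_(i > j0) `|w 0 i|]%O.
  have jmax i : `|w 0 i| <= `|w 0 j|.
    by rewrite /j; case: arg_maxP => //= m _; apply.
  have wj : w 0 j != 0.
    apply: contraNneq wN0 => wj0; apply/eqP/rowP => i; rewrite [RHS]mxE.
    by apply/eqP; rewrite -normr_le0 (le_trans (jmax i)) // wj0 normr0.
  exists j, ((w 0 j)^-1 *: w); split.
  - by apply: contraNT wj => /suppP ->.
  - by rewrite mxE mulVf.
  - apply/supn_leP; split=> // i; rewrite mxE normrM normfV mulrC.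
    by rewrite ler_pdivrMr ?normr_gt0 // mul1r.
  - by move=> i /suppP wi; rewrite mxE wi mulr0.
  - by rewrite scalerA mulfV // scale1r.
(* The new functional reads the pivot coordinate of the residual. *)
pose u' i := if i == k then col j P else u i.
have uk (z : 'rV_d) : (z *m u' k) 0 0 = (z *m P) 0 j.
  by rewrite /u' eqxx colE mulmxA -colE mxE.
have ui i : (i < k)%N -> u' i = u i by rewrite /u' => /ltn_eqF ->.
pose P' := P - col j P *m r.
have P'E (z : 'rV_d) : z *m P' = z *m P - (z *m P) 0 j *: r.
  rewrite mulmxBr mulmxA colE (mulmxA z) -colE; congr (_ - _).
  by apply/rowP => i; rewrite [LHS]mxE [RHS]mxE big_ord1 mxE.
have P'ij (z : 'rV_d) i : (z *m P') 0 i = (z *m P) 0 i - (z *m P) 0 j * r 0 i.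
  by rewrite P'E; move: (z *m P) => B; rewrite !mxE.
exists u', P', (J :\ j); split.
- by move: (cardsD1 j J); rewrite jJ cardJ add1n subnS => ->.
- move=> z i; rewrite in_setD1 negb_and negbK P'ij => /orP[/eqP->|iJ].
    by rewrite r1 mulr1 subrr.
  by rewrite rJ // mulr0 subr0 suppP.
- move=> l; rewrite ltnS leq_eqVlt P'E => /orP[/eqP->|ltlk].
    by rewrite -/w -rw subrr.
  by rewrite killP // mxE scale0r subrr.
- move=> z; rewrite P'E (le_trans (supnD _ _)) // -scaleNr.
  rewrite exprS -mulrA mulr_natl mulr2n lerD // (le_trans (supnZ_le _ _)) //.
  rewrite normrN (le_trans (ler_pM _ _ (le_supn _ _) rle)) ?supn_ge0 //.
  by rewrite mulr1.
- have le2 (z : 'rV_d) : 2 ^+ k * supn z <= 2 ^+ k.+1 * supn z.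
    by rewrite ler_wpM2r ?supn_ge0 // exprS ler_peMl ?exprn_ge0 // ler1n.
  split.
  + move=> z i; rewrite ltnS leq_eqVlt => /orP[/eqP->|ltik].
      by rewrite uk (le_trans (le_supn _ _)) // (le_trans (boundP z)) // le2.
    by rewrite ui // (le_trans (boundu z i ltik)) // le2.
  + move=> l i ltli; rewrite ltnS leq_eqVlt => /orP[/eqP ik|ltik].
      by rewrite ik uk killP -?ik // mxE.
    by rewrite ui // killu.
  + move=> z b zb; have zk : `|(z *m P) 0 j| <= b by rewrite -uk zb.
    apply: le_trans (recu z b _) _ => [i ltik|]; first by rewrite -ui // zb // ltnW.
    rewrite mulrSr -addrA lerD2l.
    have -> : z *m P = (z *m P) 0 j *: r + z *m P' by rewrite P'E addrC subrK.
    rewrite (le_trans (supnD _ _)) // lerD2r (le_trans (supnZ_le _ _)) //.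
    rewrite (le_trans (ler_pM _ _ zk rle)) ?supn_ge0 //.
    by rewrite mulr1.
Qed.

(** After d elimination steps the support [J] is empty and the residual vanishes, so the functionals
    alone control the norm. The constants depend on d only, however degenerate the flag of [y]
    is. *)
Lemma flag_functionals (R : archiRealFieldType) d (y : nat -> 'rV[R]_d) :
  exists u : nat -> 'cV[R]_d,
  [/\ forall (z : 'rV_d) i, (i < d)%N -> `|(z *m u i) 0 0| <= 2 ^+ d * supn z,
      forall l i, (l < i)%N -> (i < d)%N -> (y l *m u i) 0 0 = 0
    & forall (z : 'rV_d) (b : R), (forall i, (i < d)%N -> `|(z *m u i) 0 0| <= b) ->
        supn z <= b *+ d].
Proof.
have [u [P [J [cardJ suppP _ _ [boundu killu recu]]]]] :=
  flag_functionals_aux y (leqnn d).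
exists u; split=> // z b /recu.
suff -> : z *m P = 0 by rewrite supn0 addr0.
apply/rowP => j; rewrite [RHS]mxE suppP //.
by move: cardJ; rewrite subnn => /cards0_eq ->; rewrite inE.
Qed.

(** * Small independent approximations *)

Section Approximation.
Variables (R : archiRealFieldType) (d : nat).
Implicit Types (x : 'rV[R]_d) (v w : 'rV[int]_d.+1) (V : nat -> 'rV[int]_d.+1).

(** The linear map (q, p) |-> q x - p, acting on rows. *)
Definition shear x : 'M[R]_(d.+1, d) :=
  \matrix_(i, j) if unlift ord0 i is Some k then - (k == j)%:R else x 0 j.

Lemma mul_shear n (M : 'M[R]_(n, d.+1)) x i j :
  (M *m shear x) i j = M i ord0 * x 0 j - M i (lift ord0 j).
Proof.
rewrite mxE big_ord_recl mxE unlift_none; congr (_ + _).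
rewrite (bigD1 j) //= big1 ?addr0 => [|k kj].
  by rewrite mxE liftK eqxx mulrN1.
by rewrite mxE liftK (negPf kj) oppr0 mulr0.
Qed.

(* A vector (q, p) of Z^(d+1) stands for the rational point p/q. *)
Definition err x v := supn (map_mx intr v *m shear x).

Lemma err_ge0 x v : 0 <= err x v. Proof. exact: supn_ge0. Qed.

Lemma err_leP x v b :
  reflect (0 <= b /\ forall j, `|(v 0 ord0)%:~R * x 0 j - (v 0 (lift ord0 j))%:~R| <= b)
    (err x v <= b).
Proof.
apply: (iffP (supn_leP _ _)) => -[b0 h]; split=> // j.
  by have := h j; rewrite mul_shear !mxE.
by rewrite mul_shear !mxE.
Qed.

Definition spanmx (V : nat -> 'rV[int]_d.+1) k : 'M[R]_(k, d.+1) :=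
  \matrix_(i < k) map_mx intr (V i).

Lemma row_spanmx V k (i : 'I_k) : row i (spanmx V k) = map_mx intr (V i).
Proof. by apply/rowP => j; rewrite !mxE. Qed.

Lemma sub_spanmx V k i : (i < k)%N -> (map_mx intr (V i) <= spanmx V k)%MS.
Proof. by move=> ik; rewrite -(row_spanmx V (Ordinal ik)) row_sub. Qed.

Lemma spanmxS V i k : (i <= k)%N -> (spanmx V i <= spanmx V k)%MS.
Proof.
by move=> ik; apply/row_subP => j; rewrite row_spanmx sub_spanmx // (leq_trans _ ik).
Qed.

(** The integer points floor(x) and floor(x) + e_j, taken with denominator 1, have error at most 1.
    Together they span the whole space, since their differences are the vectors (0, e_j), so a
    subspace of dimension at most d misses one of them. *)
Lemma exists_unit_outside x k (W : 'M[R]_(k, d.+1)) : (k <= d)%N ->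
  exists v, [/\ v 0 ord0 = 1, err x v <= 1 & ~~ (map_mx intr v <= W)%MS].
Proof.
move=> kd.
pose b0 : 'rV[int]_d.+1 :=
  \row_i if unlift ord0 i is Some j then Num.floor (x 0 j) else 1.
pose b j := b0 + delta_mx 0 (lift ord0 j).
have flo (y : R) : 0 <= y - (Num.floor y)%:~R < 1.
  by rewrite subr_ge0 floor_le /= ltrBlDl; have /andP[] := floor_itv y; rewrite intrD.
have [b0W|] := boolP (map_mx intr b0 <= W)%MS; last first.
  exists b0; split=> //; first by rewrite mxE unlift_none.
  apply/err_leP; split=> // j; rewrite !mxE unlift_none liftK mul1r.
  by have /andP[h1 h2] := flo (x 0 j); rewrite ger0_norm // ltW.
have [/forallP bW|/forallPn[j bjW]] := boolP [forall j, map_mx intr (b j) <= W]%MS; last first.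
  exists (b j); split=> //; first by rewrite !mxE unlift_none /= addr0.
  apply/err_leP; split=> // i; rewrite !mxE unlift_none liftK /= addr0 mul1r.
  have /andP[h1 h2] := flo (x 0 i).
  rewrite intrD opprD addrA ler_norml; case: eqP => _ /=.
    by rewrite lerBrDr lerBlDr; lra.
  by lra.
have dW j : ((delta_mx 0 (lift ord0 j) : 'rV[R]_d.+1) <= W)%MS.
  suff -> : delta_mx 0 (lift ord0 j) = map_mx intr (b j) - map_mx intr b0 :> 'rV[R]_d.+1.
    by rewrite addmx_sub ?bW // eqmx_opp.
  by apply/rowP => i; rewrite !mxE intrD addrC addKr eqxx /=; case: eqP.
have : (1%:M <= W)%MS.
  apply/row_subP => i; rewrite rowE mulmx1.
  case: (unliftP ord0 i) => [j ->|->]; first exact: dW.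
  have -> : delta_mx 0 ord0 =
     map_mx intr b0 - \sum_j (Num.floor (x 0 j))%:~R *: delta_mx 0 (lift ord0 j) :> 'rV[R]_d.+1.
    rewrite [X in X - _]row_sum_delta big_ord_recl !mxE unlift_none scale1r.
    under eq_bigr do rewrite !mxE liftK.
    by rewrite addrK.
  by rewrite addmx_sub ?eqmx_opp // summx_sub // => j _; rewrite scalemx_sub.
by move/mxrankS; rewrite mxrank1 => /leq_trans/(_ (rank_leq_row _)); rewrite ltnNge kd.
Qed.

(** Otherwise [f] could be halved within [P] again and again, until it fell below the positive bound
    [m]. *)
Lemma exists_almost_min (T : Type) (f : T -> R) (m : R) (P : T -> Prop) t0 :
  0 < m -> (forall t, P t -> m <= f t) -> P t0 ->
  exists t, [/\ P t, f t <= f t0 & forall s, P s -> f t <= f s *+ 2].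
Proof.
move=> m0 mP Pt0; apply: NNPP => noex.
have halve n : exists t, [/\ P t, f t <= f t0 & f t *+ 2 ^ n <= f t0].
  elim: n => [|n [t [Pt tt0 tn]]]; first by exists t0.
  have [s [Ps st]] : exists s, P s /\ f s *+ 2 < f t.
    apply: NNPP => nos; apply: noex; exists t; split=> // s Ps.
    by rewrite leNgt; apply/negP => st; apply: nos; exists s.
  have s0 : 0 <= f s by rewrite (le_trans (ltW m0)) ?mP.
  exists s; split=> //; first by rewrite (le_trans _ tt0) // (le_trans _ (ltW st)) // mulr2n lerDl.
  by rewrite expnS mulrnA (le_trans _ tn) // lerMn2r // (ltW st) orbT.
have ft0 : 0 <= f t0 / m by rewrite divr_ge0 ?(ltW m0) // (le_trans (ltW m0)) ?mP.
have [t [Pt _]] := halve (Num.bound (f t0 / m)).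
apply/negP; rewrite -ltNge; have := archi_boundP ft0.
rewrite ltr_pdivrMr // => /lt_le_trans; apply.
rewrite mulr_natl; apply: le_trans (ler_wMn2r _ (mP t Pt)) _.
apply: ler_wpMn2l; first exact: le_trans (ltW m0) (mP t Pt).
exact: ltnW (ltn_expl _ _).
Qed.

(* Successive minima up to a factor 2, so that they need not be attained. *)
Lemma exists_almost_minima x (Q : nat) (m : R) : (0 < Q)%N -> 0 < m ->
  (forall v, 1 <= v 0 ord0 <= Q%:Z -> m <= err x v) ->
  exists V, forall i, (i <= d)%N ->
  [/\ 1 <= V i 0 ord0 <= Q%:Z, err x (V i) <= 1,
      ~~ (map_mx intr (V i) <= spanmx V i)%MS
    & forall w, 1 <= w 0 ord0 <= Q%:Z -> ~~ (map_mx intr w <= spanmx V i)%MS ->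
        err x (V i) <= err x w *+ 2].
Proof.
move=> Q0 m0 mP.
suff H k : (k <= d.+1)%N -> exists V, forall i, (i < k)%N ->
  [/\ 1 <= V i 0 ord0 <= Q%:Z, err x (V i) <= 1,
      ~~ (map_mx intr (V i) <= spanmx V i)%MS
    & forall w, 1 <= w 0 ord0 <= Q%:Z -> ~~ (map_mx intr w <= spanmx V i)%MS ->
        err x (V i) <= err x w *+ 2] by exact: (H d.+1).
elim: k => [_|k IHk ltkd]; first by exists (fun=> 0).
have [V hV] := IHk (ltnW ltkd).
have [v0 [v01 v0le v0V]] := exists_unit_outside x (spanmx V k) ltkd.
have [||v [[vQ vV] vle vmin]] := @exists_almost_min _ (err x) m
  (fun v => 1 <= v 0 ord0 <= Q%:Z /\ ~~ (map_mx intr v <= spanmx V k)%MS) v0 m0.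
- by move=> v [/mP].
- by split=> //; rewrite v01 lexx; lia.
exists (fun i => if i == k then v else V i) => i.
have spanE n : (n <= k)%N -> spanmx (fun i => if i == k then v else V i) n = spanmx V n.
  by move=> nk; apply/row_matrixP => j; rewrite !row_spanmx ltn_eqF // (leq_trans _ nk).
rewrite ltnS leq_eqVlt => /orP[/eqP->|ik].
  by rewrite eqxx spanE //; split=> // [|w wQ wV]; [exact: le_trans vle _|exact: vmin].
by rewrite ltn_eqF // spanE 1?ltnW //; apply: hV.
Qed.

Lemma rank_spanmx V k :
  (forall i, (i < k)%N -> ~~ (map_mx intr (V i) <= spanmx V i)%MS) ->
  \rank (spanmx V k) = k.
Proof.
move=> hV; apply/anti_leq; rewrite rank_leq_row /=.
elim: k hV => // k IHk hV.
rewrite (leq_ltn_trans (IHk _)) // => [i ik|]; first by apply: hV; rewrite ltnW.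
apply: rank_ltmx; rewrite ltmxE spanmxS //=.
by apply: contra (hV k (ltnSn k)); apply: submx_trans; rewrite sub_spanmx.
Qed.
End Approximation.

(** * Pigeonhole principle with boxes skewed along a flag *)

Section Pigeonhole.
Variables (R : archiRealFieldType) (d : nat).
Implicit Types (x : 'rV[R]_d) (v w : 'rV[int]_d.+1) (V : nat -> 'rV[int]_d.+1).

(** The vectors (q, floor(q x)) with 0 <= q <= Q have error at most 1, so each functional [u i] maps
    their errors into [-B, B]. Cut these intervals into pieces of length [s i]: two vectors in a
    common box would differ by a [v] against the last hypothesis, so there are at least Q + 1
    boxes. *)
Lemma collision_small x (Q : nat) (u : nat -> 'cV[R]_d) (B : R) (s : nat -> R) :
    0 < B -> (forall (z : 'rV_d) i, (i < d)%N -> `|(z *m u i) 0 0| <= B * supn z) ->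
    (forall i, (i < d)%N -> 0 < s i) ->
    (forall v, 1 <= v 0 ord0 <= Q%:Z ->
       exists2 i, (i < d)%N & s i <= `|(map_mx intr v *m shear x *m u i) 0 0|) ->
  Q%:R <= \prod_(i < d) (B * 2 / s i + 1).
Proof.
move=> B0 uB s0 noclose.
pose p (q : nat) : 'rV[int]_d.+1 :=
  \row_i if unlift ord0 i is Some j then Num.floor (q%:R * x 0 j) else q%:Z.
pose z q : 'rV[R]_d := map_mx intr (p q) *m shear x.
have z1 q : supn (z q) <= 1.
  apply/supn_leP; split=> // j; rewrite mul_shear !mxE unlift_none liftK.
  have /andP[h1 h2] := floor_itv (q%:R * x 0 j).
  by rewrite intrD in h2; rewrite ger0_norm ?subr_ge0 // lerBlDl ltW.
(* Shifted and rescaled, the boxes become unit cubes with integer corners, and truncation labels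
   them. *)
pose t q i : R := ((z q *m u i) 0 0 + B) / s i.
have t_bound q (i : 'I_d) : 0 <= t q i <= B * 2 / s i.
  have := le_trans (uB (z q) i (ltn_ord i)) (ler_piMr (ltW B0) (z1 q)).
  rewrite ler_norml => /andP[h1 h2]; have si := s0 _ (ltn_ord i).
  by rewrite /t divr_ge0 ?(ltW si) ?ler_pM2r ?invr_gt0 //=; lra.
pose n (i : 'I_d) := (Num.truncn (B * 2 / s i)).+1.
have tn q (i : 'I_d) : (Num.truncn (t q i) < n i)%N.
  have /andP[t0 tB] := t_bound q i.
  by rewrite /n ltnS truncn_le_nat (le_lt_trans tB) ?truncnS_gt.
pose label (q : 'I_Q.+1) : {dffun forall i, 'I_(n i)} :=
  [ffun i => Ordinal (tn q i)].
have label_inj : injective label.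
  have noeq (q1 q2 : 'I_Q.+1) : (q1 < q2)%N -> label q1 = label q2 -> False.
    move=> q12 eql.
    pose v := p q2 - p q1.
    have v0 : v 0 ord0 = q2%:Z - q1%:Z by rewrite !mxE unlift_none.
    have [|i id] := noclose v.
      by rewrite v0; have := ltn_ord q2; lia.
    apply/negP; rewrite -ltNge.
    have -> : map_mx intr v *m shear x = z q2 - z q1.
      by rewrite -mulmxBl map_mxB.
    rewrite mulmxBl mxE [X in _ + X]mxE.
    have := congr1 (fun f : {dffun forall i, 'I_(n i)} => val (f (Ordinal id))) eql.
    rewrite !ffunE /= => eqt.
    have /andP[t1 _] := t_bound q1 (Ordinal id).
    have /andP[t2 _] := t_bound q2 (Ordinal id).
    have /andP[a1 b1] := truncn_itv t1; have /andP[a2 b2] := truncn_itv t2.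
    rewrite eqt in a1 b1.
    have -> : (z q2 *m u i) 0 0 - (z q1 *m u i) 0 0 = (t q2 i - t q1 i) * s i.
      by rewrite /t -mulrBl mulfVK ?gt_eqF ?s0 //; ring.
    rewrite normrM (gtr0_norm (s0 i id)) gtr_pMl ?s0 //.
    rewrite -natr1 in b1 b2; rewrite /= in a1 b1 a2 b2.
    by rewrite ltr_norml; apply/andP; split; lra.
  move=> q1 q2 eql; case: (ltngtP q1 q2) => h; last exact: val_inj.
    by case: (noeq _ _ h eql).
  by case: (noeq _ _ h (esym eql)).
have := leq_card label label_inj.
rewrite card_ord card_dep_ffun foldrE big_map big_enum /= => /ltnW.
rewrite -(ler_nat R) => /le_trans; apply.
rewrite natr_prod; apply: ler_prod => i _; rewrite card_ord ler0n /= /n -natr1 lerD2r.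
by rewrite truncn_le divr_ge0 ?mulr_ge0 ?(ltW B0) ?ltW ?s0.
Qed.

(** Each of the d factors bounds (2 B / (c e) + 1) e, the number of pieces in one direction times
    the error e <= 1, for B = 2^d and c = 1 / (4 (d + 1)). *)
Definition minkowski_const : R := (2 ^+ d * 2 * (4 * d.+1%:R) + 1) ^+ d.

(** The rows of [M] are the almost minima [V i]. No error vector with denominator in [1, Q] is
    smaller than c err(V i) along every functional [u i] of their flag, so [collision_small] bounds
    Q by a product of terms of order 1 / err(V i). *)
Lemma small_product_basis x (Q : nat) (m : R) : (0 < Q)%N -> 0 < m ->
    (forall v, 1 <= v 0 ord0 <= Q%:Z -> m <= err x v) ->
  exists M : 'M[int]_d.+1,
  [/\ \det M != 0, forall i, 1 <= M i ord0 <= Q%:Z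
    & Q%:R * \prod_(i < d) err x (row (widen_ord (leqnSn d) i) M) <= minkowski_const].
Proof.
move=> Q0 m0 mP.
have [V hV] := exists_almost_minima Q0 m0 mP.
have VQ i (id : (i <= d)%N) : 1 <= V i 0 ord0 <= Q%:Z by case: (hV i id).
have e1 i (id : (i <= d)%N) : err x (V i) <= 1 by case: (hV i id).
have e0 i (id : (i <= d)%N) : 0 < err x (V i) by rewrite (lt_le_trans m0) ?mP ?VQ.
have Vmin i w (id : (i <= d)%N) : 1 <= w 0 ord0 <= Q%:Z ->
    ~~ (map_mx intr w <= spanmx R V i)%MS -> err x (V i) <= err x w *+ 2.
  by case: (hV i id) => _ _ _; apply.
have rankV : \rank (spanmx R V d.+1) = d.+1.
  by apply: rank_spanmx => i id; case: (hV i id).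
exists (\matrix_(i < d.+1) V i); split.
- have -> : (\det (\matrix_(i < d.+1) V i) != 0) = (spanmx R V d.+1 \in unitmx).
    have -> : spanmx R V d.+1 = map_mx intr (\matrix_(i < d.+1) V i).
      by apply/matrixP => i j; rewrite !mxE.
    by rewrite unitmxE det_map_mx unitfE intr_eq0.
  by rewrite -row_full_unit /row_full rankV.
- by move=> i; rewrite mxE VQ // -ltnS.
pose y l := map_mx intr (V l) *m shear x.
have [u [uB uker urec]] := flag_functionals y.
(* With err(V k) <= 2 err(v), each functional is at most 2 c err(V k) <= err(v) / (d + 1) on the
   error of [v]. Then d of them give err(v) <= d err(v) / (d + 1), a contradiction. *)
pose c : R := (4 * d.+1%:R)^-1.
have c0 : 0 < c by rewrite invr_gt0 mulr_gt0 ?ltr0n.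
have hQ : Q%:R <= \prod_(i < d) (2 ^+ d * 2 / (c * err x (V i)) + 1).
  apply: (@collision_small x Q u (2 ^+ d) (fun i => c * err x (V i)) _ uB).
  - by rewrite exprn_gt0.
  - by move=> i id; rewrite mulr_gt0 // e0 // ltnW.
  move=> v vQ; apply: NNPP => noclose.
  have close i : (i < d)%N -> `|(map_mx intr v *m shear x *m u i) 0 0| < c * err x (V i).
    by move=> id; rewrite ltNge; apply/negP => h; apply: noclose; exists i.
  have exk : exists k, (map_mx intr v <= spanmx R V k.+1)%MS.
    by exists d; rewrite submx_full // /row_full rankV.
  (* Here err v >= err (V k) / 2 since v is not in the span of V 0, ..., V (k-1),
     while u_i vanishes on the error vector of v for i > k. *)
  case: (ex_minnP exk) => k vk kmin.
  have kd : (k <= d)%N by apply: kmin; rewrite submx_full // /row_full rankV.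
  have vNk : ~~ (map_mx intr v <= spanmx R V k)%MS.
    case: k vk kmin {kd} => [_ _|k _ kmin].
      apply/negP => /mxrankS; rewrite [\rank (spanmx _ _ _)](eqP (_ : _ == 0%N)) -?leqn0 ?rank_leq_row //.
      rewrite leqn0 mxrank_eq0 => /eqP/rowP/(_ ord0); rewrite !mxE => /eqP.
      by rewrite intr_eq0; lia.
    by apply/negP => /kmin; rewrite ltnn.
  have ek : err x (V k) <= err x v *+ 2 by apply: Vmin.
  have small i : (i < d)%N ->
      `|(map_mx intr v *m shear x *m u i) 0 0| <= c * (err x (V k) *+ 2).
    (* For i <= k the vector [V k] lies outside the span of the first i vectors, so it competes with
       [V i] and err(V i) <= 2 err(V k). *)
    move=> id; have [ik|ki] := leqP i k.
      rewrite (le_trans (ltW (close i id))) // ler_pM2l //.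
      apply: (Vmin i (V k) (ltnW id)); first exact: VQ.
      have [_ _ + _] := hV k kd; apply: contra => Vki.
      by apply: submx_trans Vki _; apply: spanmxS.
    have /submxP[D ->] := vk.
    have -> : (D *m spanmx R V k.+1 *m shear x *m u i) = 0.
      apply/matrixP => r s; rewrite -!mulmxA !mxE big1 // => l _.
      have -> : (spanmx R V k.+1 *m (shear x *m u i)) l s = (y l *m u i) 0 0.
        rewrite (ord1 s) /y -mulmxA -row_spanmx.
        by rewrite -row_mul [RHS]mxE.
      by rewrite uker ?mulr0 // (leq_trans (ltn_ord l)).
    by rewrite mxE normr0 mulr_ge0 ?(ltW c0) ?mulrn_wge0 ?err_ge0.
  have := urec _ _ small; rewrite -/(err x v); apply/negP; rewrite -ltNge.
  have v0 : 0 < err x v by rewrite (lt_le_trans m0) ?mP.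
  have ck : c * (err x (V k) *+ 2) <= err x v / d.+1%:R.
    rewrite /c invfM mulrC mulrA ler_pM2r ?invr_gt0 ?ltr0n //.
    by rewrite ler_pdivrMr ?ltr0n //; lra.
  apply: le_lt_trans (ler_wMn2r d ck) _.
  rewrite -[X in X < _]mulr_natr -mulrA gtr_pMr // mulrC ltr_pdivrMr ?ltr0n // mul1r ltr_nat.
  exact: ltnSn.
have le_id (i : 'I_d) : (i <= d)%N by rewrite ltnW.
have rowV (i : 'I_d) : row (widen_ord (leqnSn d) i) (\matrix_(l < d.+1) V l) = V i.
  by apply/rowP => j; rewrite !mxE.
have E0 : 0 <= \prod_(i < d) err x (row (widen_ord (leqnSn d) i) (\matrix_(l < d.+1) V l)).
  by apply: prodr_ge0 => i _; apply: err_ge0.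
apply: le_trans (ler_wpM2r E0 hQ) _.
have -> : minkowski_const = \prod_(i < d) (2 ^+ d * 2 * (4 * d.+1%:R) + 1).
  by rewrite prodr_const card_ord.
rewrite -big_split /=.
apply: ler_prod => i _; rewrite rowV; have ei := e0 i (le_id i).
rewrite mulr_ge0 ?addr_ge0 ?divr_ge0 ?mulr_ge0 ?exprn_ge0 ?(ltW c0) ?(ltW ei) //=.
rewrite mulrDl lerD ?mul1r ?(e1 i (le_id i)) //.
by rewrite invfM -!mulrA mulVf ?gt_eqF // mulr1 /c invrK !mulrA.
Qed.
End Pigeonhole.

(** * Exchange of basis vectors *)

Lemma normr_det_ge1 (R : archiRealFieldType) n (M : 'M[int]_n) :
  \det M != 0 -> 1 <= `|\det (map_mx intr M : 'M[R]_n)|.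
Proof. by rewrite det_map_mx -intr_norm -(intr_eq0 R) ler1z -gtz0_ge1 normr_gt0 intr_eq0. Qed.

(** The Leibniz formula has n! terms, which cannot all be below 1/n! in absolute value. *)
Lemma det_large_term (R : archiRealFieldType) n (N : 'M[R]_n) :
  1 <= `|\det N| -> exists s : 'S_n, 1 <= n`!%:R * \prod_i `|N i (s i)|.
Proof.
move=> N1; apply: NNPP => small; move: N1; apply/negP; rewrite -ltNge.
have f0 : 0 < n`!%:R :> R by rewrite ltr0n fact_gt0.
have -> : 1 = \sum_(s : 'S_n) n`!%:R^-1 :> R.
  by rewrite sumr_const card_Sn -[RHS]mulr_natr mulVf ?gt_eqF //.
apply: le_lt_trans (ler_norm_sum _ _ _) _; apply: ltr_sum.
  by apply/hasP; exists 1%g; rewrite ?mem_index_enum.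
move=> s _; rewrite normrMsign normr_prod ltNge; apply/negP => h; apply: small.
by exists s; rewrite mulrC -ler_pdivrMr // mul1r.
Qed.

Section Exchange.
Variables (R : archiRealFieldType) (d : nat).
Implicit Types (x : 'rV[R]_d) (M : 'M[int]_d.+1).

(** The map (q, p) |-> (q, q x - p), a square completion of [shear x] that preserves determinants up
    to sign. *)
Definition full_shear x : 'M[R]_d.+1 :=
  \matrix_(i, j) if unlift ord0 j is Some k then shear x i k else (i == ord0)%:R.

Lemma mul_full_shear0 n (M : 'M[R]_(n, d.+1)) x i :
  (M *m full_shear x) i ord0 = M i ord0.
Proof.
rewrite mxE (bigD1 ord0) //= big1 => [|k k0].
  by rewrite mxE unlift_none eqxx mulr1 addr0.
by rewrite mxE unlift_none (negPf k0) mulr0.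
Qed.

Lemma mul_full_shearS n (M : 'M[R]_(n, d.+1)) x i j :
  (M *m full_shear x) i (lift ord0 j) = (M *m shear x) i j.
Proof. by rewrite !mxE; apply: eq_bigr => k _; rewrite [full_shear _ _ _]mxE liftK. Qed.

Lemma normr_det_full_shear x : `|\det (full_shear x)| = 1.
Proof.
rewrite -det_tr det_trig; last first.
  apply/is_trig_mxP => i j ij; rewrite !mxE; case: unliftP => [k ik|i0].
    rewrite mxE; case: unliftP => [l jl|j0]; last by move: ij; rewrite j0.
    rewrite -(inj_eq (@lift_inj _ ord0)) -jl -ik eq_sym -val_eqE /= ltn_eqF //.
    by rewrite oppr0.
  by rewrite -val_eqE gtn_eqF //; apply: leq_ltn_trans ij.
rewrite normr_prod big1 // => i _; rewrite !mxE; case: unliftP => [k ->|->].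
  by rewrite mxE liftK eqxx normrN normr1.
by rewrite eqxx normr1.
Qed.

(** A large Leibniz term of the sheared matrix takes the denominator column in exactly one row j and
    error entries in all others. Rows outside [S] have denominator 0, so j is in [S]; elsewhere they
    contribute at most 1. *)
Lemma det_mixed_basis x M (S : {set 'I_d.+1}) (e : 'I_d.+1 -> R) :
    \det M != 0 ->
    (forall i, i \in S -> 0 <= M i ord0 /\ forall j, `|(map_mx intr M *m shear x) i j| <= e i) ->
    (forall i, i \notin S -> M i ord0 = 0 /\ forall j, `|(map_mx intr M *m shear x) i j| <= 1) ->
  exists2 j, j \in S & 1 <= d.+1`!%:R * ((M j ord0)%:~R * \prod_(i in S :\ j) e i).
Proof.
move=> detM MS MNS; pose N := map_mx intr M *m full_shear x.
have [s hs] : exists s : 'S_d.+1, 1 <= d.+1`!%:R * \prod_i `|N i (s i)|.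
  by apply: det_large_term; rewrite det_mulmx normrM normr_det_full_shear mulr1 normr_det_ge1.
pose j := (s^-1)%g ord0; have sj : s j = ord0 by rewrite permKV.
have Nj : N j (s j) = (M j ord0)%:~R by rewrite sj /N mul_full_shear0 mxE.
have NS i : i != j -> exists k, N i (s i) = (map_mx intr M *m shear x) i k.
  move=> ij; case: (unliftP ord0 (s i)) => [k ->|si0].
    by exists k; rewrite /N mul_full_shearS.
  by move: ij; rewrite -(inj_eq (@perm_inj _ s)) sj si0 eqxx.
have jS : j \in S.
  apply: contraT => jNS; move: hs; rewrite (bigD1 j) //= Nj.
  by have [-> _] := MNS j jNS; rewrite normr0 mul0r mulr0 ler10.
exists j => //; apply: le_trans hs _; rewrite ler_pM2l ?ltr0n ?fact_gt0 //.
rewrite (bigD1 j) //= Nj ger0_norm ?ler0z; last by have [] := MS j jS.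
rewrite ler_wpM2l ?ler0z //; first by have [] := MS j jS.
rewrite [X in _ <= X]big_mkcond [X in X <= _]big_mkcond /=.
apply: ler_prod => i _; rewrite in_setD1; case: eqP => [|/eqP/NS [k ->]] /=; first by rewrite ler01 lexx.
rewrite normr_ge0; case: ifP => iS; first by have [_ ->] := MS i iS.
by have [_ ->] := MNS i (negbT iS).
Qed.

Definition replace_row M (j : 'I_d.+1) (k : 'I_d) : 'M[int]_d.+1 :=
  \matrix_(i, l) if i == j then (l == lift ord0 k)%:R else M i l.

(** If every replacement were singular, all cofactors of row j outside column 0 would vanish. Row j'
    is orthogonal to the cofactors of row j and has a nonzero entry in column 0, so the last
    cofactor would vanish too, and with it det M. *)
Lemma exchange M j j' : \det M != 0 -> j' != j -> M j' ord0 != 0 ->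
  exists k, \det (replace_row M j k) != 0.
Proof.
move=> detM j'j M0; apply/existsP; apply: contraNT detM => /existsPn noK.
have cof0 k : cofactor M j (lift ord0 k) = 0.
  apply/eqP; have := noK k; rewrite negbK (expand_det_row _ j).
  rewrite (bigD1 (lift ord0 k)) //= big1 => [|l lk].
    rewrite mxE !eqxx mul1r addr0; congr (_ == _); rewrite /cofactor; congr (_ * \det _).
    by apply/matrixP => a b; rewrite !mxE eq_sym (negPf (neq_lift _ _)).
  by rewrite mxE eqxx (negPf lk) mul0r.
have c00 : cofactor M j ord0 = 0.
  have /matrixP/(_ j' j) := mul_mx_adj M.
  rewrite mxE [RHS]mxE (negPf j'j) mulr0n big_ord_recl big1 => [|k _].
    by rewrite addr0 mxE => /eqP; rewrite mulf_eq0 (negPf M0) => /eqP.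
  by rewrite mxE cof0 mulr0.
rewrite (expand_det_row _ j) big1 // => k _.
by case: (unliftP ord0 k) => [l ->|->]; rewrite ?cof0 ?c00 mulr0.
Qed.

(* Any subfamily of the rows of M extends by unit vectors (0, e_k) to a basis,
   and det_mixed_basis relates its product of errors to that of the subfamily
   without one row j. *)
Lemma prod_err_ge x M (phi : nat -> R) : \det M != 0 -> (forall i, 1 <= M i ord0) ->
    phi 0%N <= 1 ->
    (forall i n P, phi n <= P -> 1 <= d.+1`!%:R * ((M i ord0)%:~R * P) ->
      phi n.+1 <= err x (row i M) * P) ->
  phi d <= \prod_(i < d) err x (row (widen_ord (leqnSn d) i) M).
Proof.
move=> detM M1 phi0 phiS.
have unit_shear (N : 'M[int]_d.+1) i k : (forall l, N i l = (l == lift ord0 k)%:R) ->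
    N i ord0 = 0 /\ forall j, `|(map_mx intr N *m shear x) i j| <= 1.
  move=> Ni; split=> [|j]; first by rewrite Ni.
  rewrite mul_shear !mxE !Ni /= mul0r sub0r normrN.
  by case: eqP => _; rewrite ?normr0 ?normr1.
have step (S : {set 'I_d.+1}) (N : 'M[int]_d.+1) : \det N != 0 ->
    (forall i, i \in S -> row i N = row i M) ->
    (forall i, i \notin S -> exists k, forall l, N i l = (l == lift ord0 k)%:R) ->
    exists2 j, j \in S & 1 <= d.+1`!%:R *
       ((M j ord0)%:~R * \prod_(i in S :\ j) err x (row i M)) :> R.
  move=> detN NS NNS.
  have N0 i : i \in S -> N i ord0 = M i ord0.
    by move=> iS; move/rowP/(_ ord0): (NS i iS); rewrite !mxE.
  have [|i /NNS[k]|j jS] := @det_mixed_basis x N S (fun i => err x (row i M)) detN.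
  - move=> i iS; rewrite N0 //; split=> [|j]; first exact: le_trans (M1 i).
    rewrite -(NS i iS) /err map_row -row_mul.
    by apply: le_trans (le_supn _ j); rewrite [in leRHS]mxE.
  - exact: unit_shear.
  by rewrite N0 //; exists j.
(* Induction on the size of [S]: [step] selects the row j to split off, and [exchange] turns it into
   a unit vector. The exchange uses a second row of [S] with nonzero denominator, so singletons form
   the base case. *)
have main n (S : {set 'I_d.+1}) (N : 'M[int]_d.+1) : #|S| = n.+1 -> \det N != 0 ->
    (forall i, i \in S -> row i N = row i M) ->
    (forall i, i \notin S -> exists k, forall l, N i l = (l == lift ord0 k)%:R) ->
    phi n.+1 <= \prod_(i in S) err x (row i M).
  elim: n S N => [|n IHn] S N cardS detN NS NNS.
    have [j jS hj] := step S N detN NS NNS.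
    rewrite (big_setD1 j) //=; apply: phiS => //.
    have /eqP := cardsD1 j S; rewrite jS cardS add1n eqSS eq_sym cards_eq0 => /eqP->.
    by rewrite big_set0.
  have [j jS hj] := step S N detN NS NNS.
  rewrite (big_setD1 j) //=; apply: phiS => //.
  have cardSj : #|S :\ j| = n.+1.
    by have /eqP := cardsD1 j S; rewrite jS cardS add1n eqSS eq_sym => /eqP.
  have [j' ] : exists j', j' \in S :\ j by apply/set0Pn; rewrite -card_gt0 cardSj.
  rewrite in_setD1 => /andP[j'j j'S].
  have [|k detK] := exchange detN j'j.
    move/rowP/(_ ord0): (NS j' j'S); rewrite !mxE => ->.
    by rewrite gt_eqF // (lt_le_trans _ (M1 j')).
  apply: (IHn _ (replace_row N j k)) => // i; rewrite in_setD1.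
    by move=> /andP[ij iS]; rewrite -(NS i iS); apply/rowP => l; rewrite !mxE (negPf ij).
  have [->|ij] := eqVneq i j; first by exists k => l; rewrite mxE eqxx.
  by move=> /NNS[k' hk']; exists k' => l; rewrite mxE (negPf ij).
have [d0|d_gt0] := posnP d.
  by rewrite big1 => [|i _]; [rewrite d0|have := ltn_ord i; rewrite [X in (_ < X)%N]d0].
(* The product runs over the first d rows, so the last row is exchanged for a unit vector first;
   since d > 0, row 0 is a different row. *)
have [||k detK] := @exchange M ord_max ord0 detM.
- by rewrite -val_eqE /= eq_sym -lt0n.
- by rewrite gt_eqF // (lt_le_trans _ (M1 ord0)).
have := @main d.-1 [set~ ord_max] _ _ detK.
rewrite prednK // => main_d; apply: le_trans (main_d _ _ _) _.
- by rewrite cardsC1 card_ord.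
- by move=> i; rewrite !inE => im; apply/rowP => l; rewrite !mxE (negPf im).
- by move=> i; rewrite !inE negbK => /eqP->; exists k => l; rewrite mxE eqxx.
rewrite le_eqVlt; apply/orP; left; apply/eqP.
rewrite big_mkcond big_ord_recr /= !inE eqxx mulr1.
apply: eq_bigr => i _; rewrite !inE ifT //.
by rewrite -val_eqE /= ltn_eqF.
Qed.
End Exchange.

(** * A badly approximable vector *)

Section RootOfTwo.
Variable d : nat.

(* Multiplication by X on Z[X]/(X^(d+1) - 2), acting on coefficient rows. *)
Definition mulXmx (K : comNzRingType) : 'M[K]_d.+1 :=
  \matrix_(i, j) if unlift ord0 j is Some k then (i == widen_ord (leqnSn d) k)%:R
                 else (i == ord_max)%:R *+ 2.

Lemma map_mulXmx (K L : comNzRingType) (f : {rmorphism K -> L}) : map_mx f (mulXmx K) = mulXmx L.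
Proof.
by apply/matrixP => i j; rewrite !mxE; case: unliftP => *; rewrite ?rmorph_nat ?rmorphMn /= ?rmorph1.
Qed.

Lemma mul_mulXmx0 (K : comNzRingType) n (M : 'M[K]_(n, d.+1)) i :
  (M *m mulXmx K) i ord0 = M i ord_max *+ 2.
Proof.
rewrite mxE (bigD1 ord_max) //= big1 => [|k km].
  by rewrite mxE unlift_none eqxx addr0 mulrnAr mulr1.
by rewrite mxE unlift_none (negPf km) mul0rn mulr0.
Qed.

Lemma mul_mulXmxS (K : comNzRingType) n (M : 'M[K]_(n, d.+1)) i k :
  (M *m mulXmx K) i (lift ord0 k) = M i (widen_ord (leqnSn d) k).
Proof.
rewrite mxE (bigD1 (widen_ord (leqnSn d) k)) //= big1 => [|l lk].
  by rewrite mxE liftK eqxx addr0 mulr1.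
by rewrite mxE liftK (negPf lk) mulr0.
Qed.

Lemma delta0_mulXmx (K : comNzRingType) (i : 'I_d.+1) :
  delta_mx 0 ord0 *m mulXmx K ^+ i = delta_mx 0 i :> 'rV[K]_d.+1.
Proof.
case: i => i; elim: i => [|i IHi] id.
  by rewrite expr0 mulmx1; congr delta_mx; apply: val_inj.
rewrite exprSr -mulmxE mulmxA (IHi (ltnW id)); apply/rowP => j.
case: (unliftP ord0 j) => [k ->|->].
  by rewrite mul_mulXmxS !mxE -!val_eqE.
by rewrite mul_mulXmx0 !mxE -!val_eqE /= gtn_eqF // mul0rn.
Qed.

(** The relation is checked on the basis row of 1. The other basis rows are its images under powers
    of X, which commute with X^(d+1). *)
Lemma mulXmx_root (K : comNzRingType) : mulXmx K ^+ d.+1 = 2%:M.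
Proof.
have e0 : delta_mx 0 ord0 *m mulXmx K ^+ d.+1 = 2 *: delta_mx 0 ord0 :> 'rV[K]_d.+1.
  rewrite exprSr -mulmxE mulmxA (delta0_mulXmx K ord_max); apply/rowP => j.
  case: (unliftP ord0 j) => [k ->|->].
    by rewrite mul_mulXmxS !mxE -!val_eqE /= ltn_eqF // mulr0.
  by rewrite mul_mulXmx0 !mxE !eqxx mulr1.
apply/row_matrixP => i; rewrite !rowE -(delta0_mulXmx K i) -mulmxA mulmxE -exprD addnC exprD -mulmxE.
by rewrite mulmxA e0 -scalemxAl mul_mx_scalar.
Qed.

Lemma irreducible_Xn_sub2 : irreducible_poly ('X^(d.+1) - 2%:P : {poly rat}).
Proof.
have : irreducible_poly (map_poly intr ('X^(d.+1) - 2%:P : {poly int}) : {poly rat}).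
  have sz : size ('X^(d.+1) - 2%:P : {poly int}) = d.+2 by rewrite size_XnsubC.
  apply/irreducible_rat_int; apply: (@eisenstein_crit 2) => //.
  - by rewrite sz.
  - by rewrite lead_coefE sz coefB coefXn coefC eqxx subr0.
  - by rewrite coefB coefXn coefC.
  - move=> i; rewrite sz /= coefB coefXn coefC => id.
    by rewrite ltn_eqF //; case: (i == 0%N).
by rewrite rmorphB /= map_polyXn map_polyC.
Qed.

(* The determinant is the norm of the element of Q(2^(1/(d+1))) with
   coefficient row v. *)
Lemma norm_neq0 (v : 'rV[int]_d.+1) : v != 0 ->
  \det (\matrix_(i < d.+1) (v *m mulXmx int ^+ i)) != 0.
Proof.
move=> v0; rewrite -(intr_eq0 rat) -det_map_mx; apply/det0P => -[w w0 wN].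
pose A := mulXmx rat; pose vq : 'rV[rat]_d.+1 := map_mx intr v.
(* A left kernel vector [w], read as a nonzero polynomial of degree at most d, annihilates [v]. It
   is coprime to the irreducible X^(d+1) - 2, so by Bezout it acts invertibly, which forces v =
   0. *)
have vw : vq *m horner_mx A (rVpoly w) = 0.
  rewrite -wN; apply/rowP => j.
  have -> : horner_mx A (rVpoly w) = \sum_i w 0 i *: A ^+ i.
    rewrite /rVpoly poly_def rmorph_sum /=; apply: eq_bigr => i _.
    by rewrite insubT // => id; rewrite linearZ /= rmorphXn /= horner_mx_X; congr (w 0 _ *: _); apply: val_inj.
  rewrite mulmx_sumr summxE mxE; apply: eq_bigr => i _.
  rewrite -scalemxAr mxE; congr (_ * _).
  have -> : vq *m A ^+ i = map_mx intr (v *m mulXmx int ^+ i).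
    by rewrite map_mxM /= rmorphXn /= map_mulXmx.
  by rewrite !mxE.
have cop : coprimep (rVpoly w) ('X^(d.+1) - 2%:P).
  have [_ irr] := irreducible_Xn_sub2.
  apply: contraT => /irr/(_ (dvdp_gcdr _ _)) => /eqp_dvdl dvdF.
  have := dvdp_gcdl (rVpoly w) ('X^(d.+1) - 2%:P); rewrite dvdF => /dvdp_leq.
  rewrite size_XnsubC // => /(_ _)/leq_trans/(_ (size_poly _ _)); rewrite ltnn.
  apply; apply: contraNneq w0 => rw.
  by rewrite -(rVpolyK w) rw linear0.
have /Bezout_coprimepP[[a b] /=] := cop.
rewrite -size_poly_eq1 => /size_poly1P [c c0 ab].
have : vq *m horner_mx A (rVpoly w * a + ('X^(d.+1) - 2%:P) * b) = c *: vq.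
  by rewrite mulrC [_ * b]mulrC ab horner_mx_C mul_mx_scalar.
rewrite rmorphD !rmorphM rmorphB /= rmorphXn /= horner_mx_X horner_mx_C mulXmx_root subrr mul0r addr0.
rewrite -mulmxE mulmxA vw mul0mx => /esym/eqP; rewrite scaler_eq0 (negPf c0) /=.
move=> /eqP/rowP vq0; case/eqP: v0; apply/rowP => j.
by have /eqP := vq0 j; rewrite !mxE intr_eq0 => /eqP.
Qed.

(** The row nu = (1, alpha^-1, ..., alpha^-d) is a left eigenvector of [mulXmx] for alpha, and v = q
    nu + f with f no larger than the error of [v]. The rows v X^i of the norm matrix are thus nearly
    proportional, and its determinant, a nonzero integer, is O(q err(v)^d). *)
Lemma badly_approximable_root (R : archiRealFieldType) (alpha : R) :
    1 <= alpha -> alpha ^+ d.+1 = 2 ->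
  exists2 c, 0 < c & forall v : 'rV[int]_d.+1, 1 <= v 0 ord0 ->
    c <= (v 0 ord0)%:~R * err (\row_(j < d) alpha ^- j.+1) v ^+ d.
Proof.
move=> a1 aD; have a0 : 0 < alpha by rewrite (lt_le_trans ltr01).
pose A := mulXmx R; pose x := \row_(j < d) alpha ^- j.+1.
(* One constant that bounds X^i - alpha^i on the error row f for all i <= d. *)
pose B : R := 1 + \sum_(i < d.+1) (\sum_k \sum_j `|(A ^+ i) k j| + alpha ^+ i).
have B1 : 1 <= B.
  rewrite lerDl sumr_ge0 // => i _; rewrite addr_ge0 ?exprn_ge0 ?(ltW a0) //.
  by rewrite sumr_ge0 // => k _; rewrite sumr_ge0.
have colB i j : \sum_k `|(A ^+ (i : 'I_d.+1)) k j| + alpha ^+ i <= B.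
  apply: (@le_trans _ _ (\sum_k \sum_l `|(A ^+ i) k l| + alpha ^+ i)).
    by rewrite lerD2r ler_sum // => k _; rewrite (bigD1 j) //= lerDl sumr_ge0.
  rewrite /B [X in _ <= 1 + X](bigD1 i) //= addrCA lerDl addr_ge0 // sumr_ge0 // => l _.
  by rewrite addr_ge0 ?exprn_ge0 ?(ltW a0) // sumr_ge0 // => k _; rewrite sumr_ge0.
pose C : R := d.+1`!%:R * (2 * B ^+ d).
have C1 : 1 <= C.
  rewrite /C mulr_ege1 // ?ler1n ?fact_gt0 // mulr_ege1 ?ler1n //.
  by rewrite exprn_ege1.
have C0 : 0 < C by rewrite (lt_le_trans ltr01).
exists C^-1 => [|v v1]; first by rewrite invr_gt0.
set q := v 0 ord0 in v1 *; set ee := err x v.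
have q1 : 1 <= q%:~R :> R by rewrite ler1z.
(* An error of at least 1 satisfies the bound trivially, as C >= 1. Otherwise the error is at most
   q, so row 0 is at most 2 q entrywise. *)
have [e1|/ltW e1] := leP 1 ee.
  rewrite (@le_trans _ _ 1) ?invf_le1 // mulr_ege1 ?exprn_ege1 //.
have v0 : v != 0 by apply: contraTneq v1 => v0; rewrite /q v0 mxE.
pose nu : 'rV[R]_d.+1 := \row_j alpha ^- j.
have nuA : nu *m A = alpha *: nu.
  apply/rowP => j; case: (unliftP ord0 j) => [k ->|->].
    by rewrite mul_mulXmxS !mxE /= exprS invfM mulrA mulfV ?gt_eqF // mul1r.
  rewrite mul_mulXmx0 !mxE /= expr0 invr1 mulr1 -mulr_natr -aD exprS mulrC -mulrA mulfV ?mulr1 //.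
  by rewrite gt_eqF ?exprn_gt0.
have nuAi i : nu *m A ^+ i = alpha ^+ i *: nu.
  elim: i => [|i IHi]; first by rewrite !expr0 mulmx1 scale1r.
  by rewrite exprSr -mulmxE mulmxA IHi -scalemxAl nuA scalerA -exprSr.
pose f := map_mx intr v - q%:~R *: nu.
have vE : map_mx intr v = q%:~R *: nu + f by rewrite /f addrC subrK.
have f_le : supn f <= ee.
  apply/supn_leP; split=> [|j]; first exact: err_ge0.
  case: (unliftP ord0 j) => [k ->|->].
    have := le_supn (map_mx intr v *m shear x) k; rewrite -/(err x v) -/ee.
    by rewrite mul_shear !mxE /= distrC.
  by rewrite !mxE /= expr0 invr1 mulr1 subrr normr0 err_ge0.
pose N : 'M[R]_d.+1 := \matrix_(i < d.+1) (map_mx intr v *m A ^+ i).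
have N1 : 1 <= `|\det N|.
  have -> : N = map_mx intr (\matrix_(i < d.+1) (v *m mulXmx int ^+ i)).
    apply/row_matrixP => i; rewrite -map_row !rowK map_mxM /= rmorphXn /= map_mulXmx //.
  by rewrite normr_det_ge1 // norm_neq0.
(* Subtracting alpha^i times row 0 from row i leaves only errors in row i. *)
pose L : 'M[R]_d.+1 := \matrix_(i, j) ((i == j)%:R - ((i != ord0) && (j == ord0))%:R * alpha ^+ i).
have detL : \det L = 1.
  rewrite det_trig; last first.
    apply/is_trig_mxP => i j ij; rewrite !mxE -!val_eqE /= (ltn_eqF ij).
    by rewrite (gtn_eqF (leq_ltn_trans _ ij : 0 < j)%N) // andbF mul0r subr0.
  by rewrite big1 // => i _; rewrite !mxE eqxx andNb mul0r subr0.
have LN i j : (L *m N) i j = N i j - (i != ord0)%:R * alpha ^+ i * N ord0 j.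
  rewrite mxE; under eq_bigr do rewrite mxE mulrBl.
  rewrite sumrB (bigD1 i) //= eqxx mul1r big1 ?addr0 => [|k ki]; last first.
    by rewrite eq_sym (negPf ki) mul0r.
  rewrite (bigD1 ord0) //= big1 ?addr0 => [|k k0].
    by rewrite andbT.
  by rewrite (negPf k0) andbF !mul0r.
have LN0 j : `|(L *m N) ord0 j| <= 2 * q%:~R.
  rewrite LN eqxx !mul0r subr0 mxE expr0 mulmx1 vE.
  have fj := le_trans (le_supn f j) f_le.
  have nj : `|nu 0 j| <= 1.
    by rewrite mxE normfV ger0_norm ?exprn_ge0 ?(ltW a0) // invf_le1 ?exprn_gt0 // exprn_ege1.
  rewrite mxE (le_trans (ler_normD _ _)) // mxE normrM (ger0_norm (le_trans ler01 q1)).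
  have := ler_wpM2l (le_trans ler01 q1) nj; lra.
have LNi (i : 'I_d.+1) j : i != ord0 -> `|(L *m N) i j| <= B * ee.
  move=> i0; rewrite LN i0 mul1r.
  have -> : N i j - alpha ^+ i * N ord0 j = (f *m A ^+ i) 0 j - alpha ^+ i * f 0 j.
    have -> : N i j = (map_mx intr v *m A ^+ i) 0 j by rewrite mxE.
    have -> : N ord0 j = (map_mx intr v : 'rV_d.+1) 0 j by rewrite mxE expr0 mulmx1.
    rewrite vE mulmxDl -scalemxAl nuAi.
    by move: (f *m A ^+ i) (f) => g h; rewrite !mxE; ring.
  rewrite (le_trans (ler_normB _ _)) // (le_trans _ (ler_wpM2r (err_ge0 _ _) (colB i j))) //.
  rewrite mulrDl lerD //.
    by rewrite (le_trans (normMmx_le _ _ _)) // mulrC ler_wpM2l ?sumr_ge0.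
  rewrite normrM ger0_norm ?exprn_ge0 ?(ltW a0) // ler_wpM2l ?exprn_ge0 ?(ltW a0) //.
  exact: le_trans (le_supn f j) f_le.
have [s] : exists s : 'S_d.+1, 1 <= d.+1`!%:R * \prod_i `|(L *m N) i (s i)|.
  by apply: det_large_term; rewrite det_mulmx detL mul1r.
move=> /le_trans hs; rewrite -[C^-1]mul1r ler_pdivrMr //; apply: hs.
have -> : q%:~R * ee ^+ d * C = d.+1`!%:R * (2 * q%:~R * (B * ee) ^+ d).
  by rewrite /C exprMn; ring.
rewrite ler_pM2l ?ltr0n ?fact_gt0 // big_ord_recl ler_pM ?prodr_ge0 //.
have -> : (B * ee) ^+ d = \prod_(i < d) (B * ee) by rewrite prodr_const card_ord.
by apply: ler_prod => i _; rewrite normr_ge0 LNi.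
Qed.
End RootOfTwo.

(** * Transfer to the real numbers *)

Section Bridge.
Local Notation R := Rdefinitions.R.

Definition Z_of_int (n : int) : Z :=
  match n with Posz m => Z.of_nat m | Negz m => Z.opp (Z.of_nat m.+1) end.

Definition int_of_Z (z : Z) : int :=
  match z with
  | Z0 => 0 | Zpos p => (Pos.to_nat p)%:Z | Zneg p => - (Pos.to_nat p)%:Z
  end.

Lemma IZR_Z_of_int n : IZR (Z_of_int n) = n%:~R.
Proof.
case: n => m /=; first by rewrite -INR_IZR_INZ INRE.
by rewrite NegzE mulrNz -pmulrn -[Z.neg _]/(Z.opp (Z.of_nat m.+1)) opp_IZR -INR_IZR_INZ INRE.
Qed.

Lemma int_of_ZK z : (int_of_Z z)%:~R = IZR z :> R.
Proof.
case: z => [|p|p] //=; first by rewrite -pmulrn -INRE INR_IPR.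
by rewrite mulrNz -pmulrn -INRE INR_IPR.
Qed.

Lemma maxnorm_leP d v b : reflect (0 <= b /\ forall i, (i < d)%N -> `|v i| <= b) (maxnorm d v <= b).
Proof.
apply: (iffP idP); elim: d => [|d IHd] /=; rewrite ?RmaxE ?ge_max.
- by split.
- move=> /andP[/IHd[b0 h] vd]; split=> // i; rewrite ltnS leq_eqVlt.
  by case/orP => [/eqP->|]; [rewrite -RabsE|exact: h].
- by case.
- move=> [b0 h]; rewrite IHd ?RabsE ?h //; split=> // i id; apply: h.
  exact: ltnW.
Qed.

Lemma maxnorm_err d (x : nat -> R) (p : nat -> Z) (q : nat) (v : 'rV[int]_d.+1) :
  (0 < q)%N -> v 0 ord0 = q -> (forall j : 'I_d, (v 0 (lift ord0 j))%:~R = IZR (p j)) ->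
  INR q * maxnorm d (fun i => Rminus (x i) (Rdiv (IZR (p i)) (INR q))) = err (\row_(j < d) x j) v.
Proof.
move=> q0 vq vp; rewrite INRE; have q0' : 0 < q%:R :> R by rewrite ltr0n.
have scale (j : 'I_d) : `|(v 0 ord0)%:~R * (\row_(j < d) x j) 0 j - (v 0 (lift ord0 j))%:~R|
    = q%:R * `|Rminus (x j) (Rdiv (IZR (p j)) q%:R)|.
  rewrite vq vp mxE -[X in _ = X * _](gtr0_norm q0') -normrM RminusE RdivE mulrBr -pmulrn.
  by congr `|_ - _|; rewrite mulrC mulfVK ?gt_eqF.
apply/le_anti/andP; split.
  rewrite -ler_pdivlMl //; apply/maxnorm_leP; split=> [|i id].
    by rewrite mulr_ge0 ?err_ge0 // invr_ge0 ltW.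
  have /err_leP[_ /(_ (Ordinal id))] := lexx (err (\row_(j < d) x j) v).
  by rewrite scale ler_pdivlMl.
have /maxnorm_leP[m0 h] := lexx (maxnorm d (fun i => Rminus (x i) (Rdiv (IZR (p i)) q%:R))).
apply/err_leP; split=> [|j]; first by rewrite mulr_ge0 // ltW.
by rewrite scale ler_pM2l // h.
Qed.

Lemma badly_approximable d : exists c x, Rlt 0 c /\ forall (p : nat -> Z) q, le 1 q ->
  Rle c (Rmult (INR q)
    (pow (Rmult (INR q) (maxnorm d (fun i => Rminus (x i) (Rdiv (IZR (p i)) (INR q))))) d)).
Proof.
pose alpha := Rpower 2 (/ INR d.+1).
have d0 : INR d.+1 <> 0 by rewrite INRE; apply/eqP; rewrite pnatr_eq0.
have aD : alpha ^+ d.+1 = 2.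
  rewrite -RpowE -Rpower_pow; last exact: exp_pos.
  rewrite Rpower_mult Rinv_l // Rpower_1 //.
  by apply: Rlt_0_2.
have a1 : 1 <= alpha.
  rewrite leNgt; apply/negP => a1; have : alpha ^+ d.+1 < 1.
    by rewrite exprn_ilt1 //; apply/RleP/Rlt_le/exp_pos.
  by rewrite aD ltrn1.
have [c c0 hc] := badly_approximable_root a1 aD.
pose x (j : nat) : R := alpha ^- j.+1.
exists c, x; split; first exact/RltP.
move=> p q /ssrnat.leP q1; pose v : 'rV[int]_d.+1 :=
  \row_i if unlift ord0 i is Some j then int_of_Z (p j) else q%:Z.
have v0 : v 0 ord0 = q by rewrite mxE unlift_none.
rewrite !RmultE (@maxnorm_err d x p q v q1 v0); last by move=> j; rewrite mxE liftK int_of_ZK.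
apply/RleP; rewrite INRE RpowE; have := hc v; rewrite v0 -pmulrn; apply.
by rewrite lez_nat.
Qed.

(* phi n bounds from below the product of the errors of any n of d independent
   rational points; the pigeonhole principle bounds the full product by C/Q. *)
Lemma chain_bound d : exists C, forall (x : nat -> R) (Q : nat) (m : R), le 1 Q -> Rlt 0 m ->
    (forall (p : nat -> Z) (q : nat), le 1 q -> le q Q ->
       Rle m (INR q * maxnorm d (fun i => Rminus (x i) (Rdiv (IZR (p i)) (INR q))))) ->
  forall phi : nat -> R, Rle (phi O) 1 ->
    (forall (n : nat) (P : R) (p : nat -> Z) (q : nat), le 1 q -> le q Q -> Rle (phi n) P ->
       Rle 1 (INR (fact d.+1) * (INR q * P)) ->
       Rle (phi n.+1) (INR q * maxnorm d (fun i => Rminus (x i) (Rdiv (IZR (p i)) (INR q))) * P)) ->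
  Rle (INR Q * phi d) C.
Proof.
exists (minkowski_const R d) => x Q m /ssrnat.leP Q1 /RltP m0 mP phi /RleP phi0 phiS.
pose X := \row_(j < d) x j.
have toq (v : 'rV[int]_d.+1) : 1 <= v 0 ord0 <= Q -> exists q : nat, exists p : nat -> Z,
   [/\ v 0 ord0 = q, le 1 q, le q Q &
    INR q * maxnorm d (fun i => Rminus (x i) (Rdiv (IZR (p i)) (INR q))) = err X v].
  move=> v1; exists (absz (v 0 ord0)).
  exists (fun i => if insub i is Some j then Z_of_int (v 0 (lift ord0 (j : 'I_d))) else Z0).
  have vq : v 0 ord0 = absz (v 0 ord0) by lia.
  split=> //; try by apply/ssrnat.leP; lia.
  apply: maxnorm_err => //; first by lia.
  by move=> j; rewrite valK IZR_Z_of_int.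
have [v|M [detM M1 prodM]] := @small_product_basis R d X Q m Q1 m0.
  by move=> /toq [q [p [_ q1 qQ <-]]]; apply/RleP; apply: mP.
apply/RleP; apply: le_trans prodM; rewrite INRE ler_wpM2l //.
apply: (@prod_err_ge R d X M phi detM _ phi0) => [i|i n P Pn]; first by have /andP[] := M1 i.
have [|q [p [vq q1 qQ <-]]] := toq (row i M); first by rewrite mxE.
move: vq; rewrite mxE => -> hP; apply/RleP.
by apply: phiS => //; apply/RleP => //; rewrite factE !INRE.
Qed.
End Bridge.
End GeometryOfNumbers.

(** * Exponents *)

Lemma Rpower_pos x y : 0 < Rpower x y.
Proof. exact (exp_pos _). Qed.

Lemma Rpower_base_neg x y c : c <= 0 -> 0 < x <= y -> Rpower y c <= Rpower x c.
Proof.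
  intros Hc Hxy.
  replace c with (- - c) by ring.
  rewrite (Rpower_Ropp y (- c)), (Rpower_Ropp x (- c)).
  apply Rinv_le_contravar; [apply Rpower_pos | apply Rle_Rpower_l; lra].
Qed.

Lemma Rpower_le_1 x c : c <= 0 -> 1 <= x -> Rpower x c <= 1.
Proof.
  intros Hc Hx. rewrite <- (Rpower_O x) by lra. now apply Rle_Rpower.
Qed.

Lemma Rpower_ge_1 x c : 0 <= c -> 1 <= x -> 1 <= Rpower x c.
Proof.
  intros Hc Hx. rewrite <- (Rpower_O x) by lra. now apply Rle_Rpower.
Qed.

Lemma INR_ge_1 n : (1 <= n)%nat -> 1 <= INR n.
Proof. intros Hn. apply (le_INR 1 n Hn). Qed.

Lemma Rpower_pow_root x y n : (1 <= n)%nat -> 0 < x -> Rpower x y = Rpower x (y / INR n) ^ n.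
Proof.
  intros Hn Hx. rewrite <- Rpower_pow by apply Rpower_pos.
  rewrite Rpower_mult. f_equal. field.
  pose proof (INR_ge_1 n Hn); lra.
Qed.

Lemma maxnorm_ge0 d v : 0 <= maxnorm d v.
Proof. induction d; simpl; [lra | eapply Rle_trans; [exact IHd | apply Rmax_l]]. Qed.

Lemma Rabs_le_maxnorm d v i : (i < d)%nat -> Rabs (v i) <= maxnorm d v.
Proof.
  induction d; simpl; intros Hi; [lia |].
  destruct (Nat.eq_dec i d) as [-> | Hne]; [apply Rmax_r |].
  eapply Rle_trans; [apply IHd; lia | apply Rmax_l].
Qed.

Lemma maxnorm_le d v b : 0 <= b -> (forall i, (i < d)%nat -> Rabs (v i) <= b) -> maxnorm d v <= b.
Proof.
  intros Hb. induction d; simpl; intros Hv; [exact Hb |].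
  apply Rmax_lub; [apply IHd; intros; apply Hv; lia | apply Hv; lia].
Qed.

Lemma maxnorm_ext d v w : (forall i, (i < d)%nat -> v i = w i) -> maxnorm d v = maxnorm d w.
Proof.
  induction d; simpl; intros Hv; [reflexivity |].
  rewrite IHd by (intros; apply Hv; lia). now rewrite Hv by lia.
Qed.

(** * Approximation up to constants, and the upper bounds *)

Definition dist d (x : nat -> R) (p : nat -> Z) (q : nat) : R :=
  maxnorm d (fun i => x i - IZR (p i) / INR q).

Lemma dist_ge0 d x p q : 0 <= dist d x p q.
Proof. apply maxnorm_ge0. Qed.

Definition all_approx (d : nat) (a A : R) : Prop :=
  exists kappa, 0 < kappa /\ forall x Q, (1 <= Q)%nat ->
    exists p q, (1 <= q)%nat /\ (q <= Q)%nat /\ dist d x p q <= PsiaA kappa a A q Q.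

(** The point may depend on [Q]. This still refutes uniform approximability, where one threshold
    must serve all points. *)
Definition some_unapprox (d : nat) (a A : R) : Prop :=
  exists eps, 0 < eps /\ forall Q, (1 <= Q)%nat ->
    exists x, forall p q, (1 <= q)%nat -> (q <= Q)%nat -> PsiaA eps a A q Q <= dist d x p q.

Lemma exists_rounding (q : nat) (y : R) : (1 <= q)%nat ->
  exists z, Rabs (y - IZR z / INR q) <= / INR q.
Proof.
  intros Hq. pose proof (INR_ge_1 q Hq) as Hq1.
  exists (Int_part (INR q * y)).
  destruct (base_Int_part (INR q * y)) as [H1 H2].
  replace (y - IZR (Int_part (INR q * y)) / INR q)
    with ((INR q * y - IZR (Int_part (INR q * y))) * / INR q) by (field; lra).
  assert (0 < / INR q) by (apply Rinv_0_lt_compat; lra).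
  rewrite Rabs_right by (apply Rle_ge, Rmult_le_pos; lra).
  rewrite <- (Rmult_1_l (/ INR q)) at 2.
  apply Rmult_le_compat_r; lra.
Qed.

Lemma exists_rounding_vector d (q : nat) (x : nat -> R) : (1 <= q)%nat ->
  exists p, dist d x p q <= / INR q.
Proof.
  intros Hq. pose proof (INR_ge_1 q Hq) as Hq1.
  induction d as [| d [p IHd]].
  - exists (fun _ => 0%Z). unfold dist; simpl. left; apply Rinv_0_lt_compat; lra.
  - destruct (exists_rounding q (x d) Hq) as [z Hz].
    exists (fun i => if Nat.eq_dec i d then z else p i).
    unfold dist; simpl. apply Rmax_lub.
    + erewrite maxnorm_ext; [exact IHd |].
      intros i Hi; simpl. destruct (Nat.eq_dec i d); [lia | reflexivity].
    + destruct (Nat.eq_dec d d); [exact Hz | lia].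
Qed.

(** The largest denominator q = Q is the right choice: rounding gives distance at most 1/Q = Q^-a
    Q^-(1-a). *)
Lemma all_approx_neg d a : a <= 0 -> all_approx d a (1 - a).
Proof.
  intros Ha. exists 1. split; [lra |]. intros x Q HQ.
  destruct (exists_rounding_vector d Q x HQ) as [p Hp].
  exists p, Q. split; [lia | split; [lia |]].
  eapply Rle_trans; [exact Hp |]. unfold PsiaA.
  pose proof (INR_ge_1 Q HQ).
  rewrite Rmult_assoc, <- Rpower_plus.
  replace (- a + - (1 - a)) with (- (1)) by ring.
  rewrite Rpower_Ropp, Rpower_1 by lra. lra.
Qed.

Lemma all_approx_zero d a : all_approx d a 0.
Proof.
  exists 1. split; [lra |]. intros x Q HQ.
  destruct (exists_rounding_vector d 1 x (le_n 1)) as [p Hp].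
  exists p, 1%nat. split; [lia | split; [lia |]].
  eapply Rle_trans; [exact Hp |]. unfold PsiaA. simpl INR.
  rewrite Ropp_0, Rpower_O by (pose proof (INR_ge_1 Q HQ); lra).
  unfold Rpower. rewrite ln_1, Rmult_0_r, exp_0. lra.
Qed.

(** Without a good p/q every error |q x - p| would be at least q Psi(q, Q). Then [phi] would bound
    products of errors from below, and [chain_bound] would contradict C < Q phi(d). The bound [m]
    keeps the errors away from 0. *)
Lemma pigeonhole_approx d : (1 <= d)%nat -> exists C, 0 < C /\
  forall a A kappa x Q m, (1 <= Q)%nat -> 0 < m ->
    (forall q, (1 <= q)%nat -> (q <= Q)%nat -> m <= INR q * PsiaA kappa a A q Q) ->
    forall phi : nat -> R, phi O <= 1 ->
    (forall n P q, (1 <= q)%nat -> (q <= Q)%nat -> phi n <= P ->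
       1 <= INR (fact (S d)) * (INR q * P) -> phi (S n) <= INR q * PsiaA kappa a A q Q * P) ->
    C < INR Q * phi d ->
    exists p q, (1 <= q)%nat /\ (q <= Q)%nat /\ dist d x p q <= PsiaA kappa a A q Q.
Proof.
  intros Hd. destruct (GeometryOfNumbers.chain_bound d) as [C HC].
  exists (Rabs C + 1). split; [pose proof (Rabs_pos C); lra |].
  intros a A kappa x Q m HQ Hm Hlow phi Hphi0 HphiS Hbig.
  apply NNPP. intros Hno.
  assert (Hfar : forall p q, (1 <= q)%nat -> (q <= Q)%nat ->
            INR q * PsiaA kappa a A q Q <= INR q * dist d x p q).
  { intros p q H1 H2. apply Rmult_le_compat_l; [apply pos_INR |].
    apply Rnot_lt_le. intros Hlt. apply Hno. exists p, q. repeat split; auto; lra. }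
  apply (Rlt_irrefl C).
  apply Rlt_le_trans with (INR Q * phi d); [pose proof (Rle_abs C); lra |].
  apply (HC x Q m HQ Hm); [| exact Hphi0 |].
  - intros p q H1 H2. eapply Rle_trans; [now apply (Hlow q) | now apply (Hfar p q)].
  - intros n P p q H1 H2 HP HK. eapply Rle_trans; [now apply (HphiS n P q) |].
    apply Rmult_le_compat_r; [| now apply (Hfar p q)].
    apply Rnot_lt_le. intros HP0.
    assert (0 < INR (fact (S d)) * INR q).
    { apply Rmult_lt_0_compat; [apply INR_fact_lt_0 |].
      pose proof (INR_ge_1 q H1); lra. }
    nra.
Qed.

Lemma INR_PsiaA kappa a A q Q : (1 <= q)%nat ->
  INR q * PsiaA kappa a A q Q = kappa * Rpower (INR q) (1 - a) * Rpower (INR Q) (- A).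
Proof.
  intros Hq. pose proof (INR_ge_1 q Hq). unfold PsiaA, Rminus.
  rewrite Rpower_plus, Rpower_1 by lra. ring.
Qed.

(** For a >= 1 the factor q^(1-a) is smallest at q = Q, so m = kappa Q^(-1/d) is a uniform lower
    bound for q Psi(q, Q). With phi n = m^n, Q phi(d) is kappa^d, which exceeds C. *)
Lemma all_approx_ge1 d a : (1 <= d)%nat -> 1 <= a -> all_approx d a (1 + / INR d - a).
Proof.
  intros Hd Ha. destruct (pigeonhole_approx d Hd) as [C [HC H]].
  set (kappa := 1 + C). exists kappa. split; [unfold kappa; lra |].
  intros x Q HQ. pose proof (INR_ge_1 Q HQ) as HQ1.
  set (m := kappa * Rpower (INR Q) (- 1 / INR d)).
  assert (Hm : 0 < m) by (apply Rmult_lt_0_compat; [unfold kappa; lra | apply Rpower_pos]).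
  assert (Hlow : forall q, (1 <= q)%nat -> (q <= Q)%nat ->
            m <= INR q * PsiaA kappa a (1 + / INR d - a) q Q).
  { intros q H1 H2. rewrite INR_PsiaA by exact H1. unfold m.
    replace (- 1 / INR d) with ((1 - a) + - (1 + / INR d - a)) by (unfold Rdiv; ring).
    rewrite Rpower_plus, Rmult_assoc.
    apply Rmult_le_compat_l; [unfold kappa; lra |].
    apply Rmult_le_compat_r; [left; apply Rpower_pos |].
    apply Rpower_base_neg; [lra |].
    split; [pose proof (INR_ge_1 q H1); lra | now apply le_INR]. }
  apply (H a (1 + / INR d - a) kappa x Q m HQ Hm Hlow (fun n => m ^ n)).
  - simpl; lra.
  - intros n P q H1 H2 HP HK. simpl.
    apply Rmult_le_compat; [lra | left; now apply pow_lt | now apply Hlow | exact HP].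
  - unfold m. rewrite Rpow_mult_distr, <- Rpower_pow_root by (auto; lra).
    replace (-1) with (- (1)) by ring. rewrite Rpower_Ropp, Rpower_1 by lra.
    replace (INR Q * (kappa ^ d * / INR Q)) with (kappa ^ d) by (field; lra).
    apply Rlt_le_trans with kappa; [unfold kappa; lra |].
    rewrite <- (pow_1 kappa) at 1. apply Rle_pow; [unfold kappa; lra | exact Hd].
Qed.

(** The value 0 at n = 0 is the exponent of an empty product of errors, where the recursion [geom_S]
    starts. *)
Definition geom (a : R) (n : nat) : R :=
  match n with O => 0 | S k => sum_f_R0 (fun i => a ^ i) k end.

Lemma geom_S a n : geom a (S n) = 1 + a * geom a n.
Proof.
  induction n as [| n IHn]; [simpl; ring |].
  transitivity (geom a (S n) + a ^ S n); [reflexivity |].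
  rewrite IHn at 1. destruct n as [| n]; [simpl; ring |].
  change (geom a (S (S n))) with (geom a (S n) + a ^ S n). simpl pow. ring.
Qed.

Lemma geom_ge_1 a n : 0 <= a -> 1 <= geom a (S n).
Proof.
  intros Ha. induction n as [| n IHn]; [simpl; lra |].
  rewrite geom_S. nra.
Qed.

(** Write q^(1-a) P = (q P)^(1-a) P^a. The first factor is at least K^-(1-a) >= 1/K, and the second
    is at least Q^(-A a s). *)
Lemma chain_step K kappa a A s q Q P :
  0 <= a <= 1 -> 1 <= K -> 0 < kappa -> 0 < q -> 1 <= Q ->
  Rpower Q (- (A * s)) <= P -> 1 <= K * (q * P) ->
  kappa / K * Rpower Q (- (A * (1 + a * s))) <=
    kappa * Rpower q (1 - a) * Rpower Q (- A) * P.
Proof.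
  intros Ha HK Hk Hq HQ HP HKq.
  assert (HP0 : 0 < P) by (pose proof (Rpower_pos Q (- (A * s))); lra).
  assert (HqP : / K <= q * P).
  { apply Rmult_le_reg_l with K; [lra |]. rewrite Rinv_r by lra. exact HKq. }
  assert (HiK : 0 < / K) by (apply Rinv_0_lt_compat; lra).
  assert (H1 : / K <= Rpower (q * P) (1 - a)).
  { apply Rle_trans with (Rpower (/ K) (1 - a)); [| apply Rle_Rpower_l; lra].
    replace (/ K) with (Rpower K (- (1))) at 1 by (rewrite Rpower_Ropp, Rpower_1; lra).
    replace (Rpower (/ K) (1 - a)) with (Rpower K (- (1 - a))).
    - apply Rle_Rpower; lra.
    - replace (/ K) with (Rpower K (- (1))) by (rewrite Rpower_Ropp, Rpower_1; lra).
      rewrite Rpower_mult. f_equal. ring. }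
  assert (H2 : Rpower Q (- (A * (a * s))) <= Rpower P a).
  { replace (- (A * (a * s))) with (- (A * s) * a) by ring.
    rewrite <- Rpower_mult. apply Rle_Rpower_l; [lra |].
    split; [apply Rpower_pos | exact HP]. }
  assert (HPs : P = Rpower P (1 - a) * Rpower P a).
  { rewrite <- Rpower_plus. replace (1 - a + a) with 1 by ring. now rewrite Rpower_1. }
  rewrite HPs.
  replace (kappa * Rpower q (1 - a) * Rpower Q (- A) * (Rpower P (1 - a) * Rpower P a))
    with (kappa * Rpower Q (- A) * (Rpower (q * P) (1 - a) * Rpower P a))
    by (rewrite <- Rpower_mult_distr by lra; ring).
  replace (- (A * (1 + a * s))) with (- A + - (A * (a * s))) by ring.
  rewrite Rpower_plus.
  replace (kappa / K * (Rpower Q (- A) * Rpower Q (- (A * (a * s)))))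
    with (kappa * Rpower Q (- A) * (/ K * Rpower Q (- (A * (a * s))))) by (field; lra).
  apply Rmult_le_compat_l.
  - apply Rmult_le_pos; [lra | left; apply Rpower_pos].
  - apply Rmult_le_compat; [lra | left; apply Rpower_pos | exact H1 | exact H2].
Qed.

(** Iterating s |-> 1 + a s from 0 yields the exponents [geom a n]. The choice of [A] makes the last
    power of Q equal to 1/Q, so that Q phi(d) = 1 + C. *)
Lemma all_approx_01 d a : (1 <= d)%nat -> 0 <= a <= 1 -> all_approx d a (/ geom a d).
Proof.
  intros Hd Ha. destruct (pigeonhole_approx d Hd) as [C [HC H]].
  set (A := / geom a d). set (K := INR (fact (S d))).
  assert (HK : 1 <= K) by (apply INR_ge_1; pose proof (lt_O_fact (S d)); lia).
  set (kappa := K * (1 + C)).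
  assert (Hkappa : 0 < kappa) by (apply Rmult_lt_0_compat; lra).
  assert (HkK : kappa / K = 1 + C) by (unfold kappa; field; lra).
  exists kappa. split; [exact Hkappa |].
  intros x Q HQ. pose proof (INR_ge_1 Q HQ) as HQ1.
  set (m := kappa * Rpower (INR Q) (- A)).
  assert (Hm : 0 < m) by (apply Rmult_lt_0_compat; [lra | apply Rpower_pos]).
  (* The factor 1 + C = kappa / K does not accumulate: each step uses only the power of Q from the
     previous one. At n = 0 the requirement phi 0 <= 1 excludes this factor. *)
  set (phi n := match n with O => 1 | S _ => (1 + C) * Rpower (INR Q) (- (A * geom a n)) end).
  apply (H a A kappa x Q m HQ Hm) with (phi := phi).
  - intros q H1 H2. rewrite INR_PsiaA by exact H1. unfold m.
    apply Rmult_le_compat_r; [left; apply Rpower_pos |].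
    pose proof (Rpower_ge_1 (INR q) (1 - a) ltac:(lra) (INR_ge_1 q H1)). nra.
  - simpl; lra.
  - intros n P q H1 H2 HP HKq. rewrite INR_PsiaA by exact H1.
    unfold phi at 1. rewrite geom_S, <- HkK.
    apply chain_step; auto; [pose proof (INR_ge_1 q H1); lra |].
    eapply Rle_trans; [| exact HP]. destruct n as [| n].
    + simpl. rewrite Rmult_0_r, Ropp_0, Rpower_O; lra.
    + unfold phi. pose proof (Rpower_pos (INR Q) (- (A * geom a (S n)))). nra.
  - destruct d as [| d]; [lia |]. unfold phi.
    assert (HA : A * geom a (S d) = 1).
    { unfold A. apply Rinv_l. pose proof (geom_ge_1 a d ltac:(lra)). lra. }
    rewrite HA, Rpower_Ropp, Rpower_1 by lra.
    replace (INR Q * ((1 + C) * / INR Q)) with (1 + C) by (field; lra). lra.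
Qed.

(** * Lower bounds: points far from all rationals of bounded height *)

(** The point is halfway between 0 and 1/T, while p/q is either at most 0 or at least 1/q >= 1/T. *)
Lemma offset_dist_ge T (p : Z) (q : nat) : (1 <= q)%nat -> INR q <= T ->
  / (2 * T) <= Rabs (/ (2 * T) - IZR p / INR q).
Proof.
  intros Hq HT. pose proof (INR_ge_1 q Hq) as Hq1.
  assert (Hi : 0 < / T) by (apply Rinv_0_lt_compat; lra).
  assert (HiT : / T <= / INR q) by (apply Rinv_le_contravar; lra).
  replace (/ (2 * T)) with (/ T / 2) by (field; lra). 
  change (IZR p / INR q) with (IZR p * / INR q).
  destruct (Z_le_gt_dec p 0) as [Hp | Hp].
  - assert (IZR p <= 0) by now apply IZR_le.
    assert (IZR p * / INR q <= 0) by nra.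
    rewrite Rabs_right; lra.
  - assert (1 <= IZR p) by (apply IZR_le; lia).
    assert (/ INR q <= IZR p * / INR q) by nra.
    rewrite Rabs_left; lra.
Qed.

Lemma some_unapprox_neg d a : (1 <= d)%nat -> a <= 0 -> some_unapprox d a (1 - a).
Proof.
  intros Hd Ha. exists (/ 2). split; [lra |]. intros Q HQ.
  pose proof (INR_ge_1 Q HQ) as HQ1.
  exists (fun _ => / (2 * INR Q)). intros p q H1 H2.
  pose proof (INR_ge_1 q H1) as Hq1.
  apply Rle_trans with (/ (2 * INR Q)).
  - unfold PsiaA. apply Rle_trans with (/ 2 * Rpower (INR Q) (- a) * Rpower (INR Q) (- (1 - a))).
    + apply Rmult_le_compat_r; [left; apply Rpower_pos |].
      apply Rmult_le_compat_l; [lra |].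
      apply Rle_Rpower_l; [lra | split; [lra | now apply le_INR]].
    + rewrite Rmult_assoc, <- Rpower_plus.
      replace (- a + - (1 - a)) with (- (1)) by ring.
      rewrite Rpower_Ropp, Rpower_1 by lra. right. field. lra.
  - eapply Rle_trans; [now apply (offset_dist_ge (INR Q) (p O) q); [| apply le_INR] |].
    apply (Rabs_le_maxnorm d (fun i => / (2 * INR Q) - IZR (p i) / INR q) 0 Hd).
Qed.

(* The last coordinate of x is 1/(2T): it forces distance at least 1/(2T), which
   is enough for q >= T^(1/(a+g)), and the other coordinates form a point which
   is badly approximable up to height T^(1/(a+g)). *)
Lemma unapprox_01 n a : 0 <= a <= 1 -> exists eps, 0 < eps /\ forall T, 1 <= T ->
  exists x, forall p q, (1 <= q)%nat -> INR q <= T ->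
    eps * Rpower (INR q) (- a) * Rpower T (- / geom a (S n)) <= dist (S n) x p q.
Proof.
  intros Ha. induction n as [| n [eps [Heps IHn]]].
  - exists (/ 2). split; [lra |]. intros T HT.
    exists (fun _ => / (2 * T)). intros p q H1 H2.
    eapply Rle_trans; [| unfold dist; simpl; apply Rmax_r].
    eapply Rle_trans; [| now apply offset_dist_ge].
    simpl geom. rewrite Rinv_1, (Rpower_Ropp T), (Rpower_1 T) by lra.
    pose proof (Rpower_le_1 (INR q) (- a) ltac:(lra) (INR_ge_1 q H1)).
    replace (/ (2 * T)) with (/ 2 * 1 * / T) by (field; lra).
    apply Rmult_le_compat_r; [left; apply Rinv_0_lt_compat; lra | lra].
  - set (s := geom a (S n)) in *. set (g := / s).
    assert (Hs : 1 <= s) by (apply geom_ge_1; lra).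
    assert (Hg : 0 < g) by (apply Rinv_0_lt_compat; lra).
    (* At height T' = T^b both regimes meet: T'^-(a+g) = 1/T. As T' is rarely an integer, the
       induction runs over real heights. *)
    set (b := / (a + g)).
    assert (Hb : 0 < b) by (apply Rinv_0_lt_compat; lra).
    assert (Hf : / geom a (S (S n)) = g * b).
    { rewrite geom_S. fold s. unfold b, g.
      assert (0 <= a * s) by nra. field. repeat split; lra. }
    exists (Rmin eps (/ 2)). split; [apply Rmin_pos; lra |]. intros T HT.
    set (T' := Rpower T b).
    assert (HT' : 1 <= T') by (apply Rpower_ge_1; lra).
    destruct (IHn T' HT') as [x Hx].
    exists (fun i => if Nat.eq_dec i (S n) then / (2 * T) else x i).
    intros p q H1 H2. pose proof (INR_ge_1 q H1) as Hq1.
    assert (HTf : Rpower T (- / geom a (S (S n))) = Rpower T' (- g)).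
    { unfold T'. rewrite Rpower_mult, Hf. f_equal. ring. }
    rewrite HTf.
    destruct (Rle_lt_dec (INR q) T') as [HqT | HqT].
    + apply Rle_trans with (dist (S n) x p q).
      * eapply Rle_trans; [| now apply Hx].
        apply Rmult_le_compat_r; [left; apply Rpower_pos |].
        apply Rmult_le_compat_r; [left; apply Rpower_pos | apply Rmin_l].
      * unfold dist. apply maxnorm_le; [apply maxnorm_ge0 |]. intros i Hi.
        pose proof (Rabs_le_maxnorm (S (S n)) (fun i =>
          (if Nat.eq_dec i (S n) then / (2 * T) else x i) - IZR (p i) / INR q) i ltac:(lia)) as Hm.
        cbv beta in Hm. destruct (Nat.eq_dec i (S n)); [lia | exact Hm].
    + apply Rle_trans with (/ (2 * T)).
      * apply Rle_trans with (/ 2 * Rpower T' (- a) * Rpower T' (- g)).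
        -- apply Rmult_le_compat_r; [left; apply Rpower_pos |].
           apply Rmult_le_compat; [apply Rmin_glb; lra | left; apply Rpower_pos | apply Rmin_r |].
           apply Rpower_base_neg; lra.
        -- rewrite Rmult_assoc, <- Rpower_plus. unfold T'. rewrite Rpower_mult.
           replace (b * (- a + - g)) with (- (1)) by (unfold b; field; lra).
           rewrite Rpower_Ropp, Rpower_1 by lra. right. field. lra.
      * eapply Rle_trans; [now apply (offset_dist_ge T (p (S n)) q) |].
        pose proof (Rabs_le_maxnorm (S (S n)) (fun i =>
          (if Nat.eq_dec i (S n) then / (2 * T) else x i) - IZR (p i) / INR q) (S n) ltac:(lia)) as Hm.
        cbv beta in Hm. destruct (Nat.eq_dec (S n) (S n)); [exact Hm | lia].
Qed.

Lemma some_unapprox_01 d a : (1 <= d)%nat -> 0 <= a <= 1 -> some_unapprox d a (/ geom a d).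
Proof.
  intros Hd Ha. destruct d as [| n]; [lia |].
  destruct (unapprox_01 n a Ha) as [eps [Heps H]].
  exists eps. split; [exact Heps |]. intros Q HQ.
  destruct (H (INR Q) (INR_ge_1 Q HQ)) as [x Hx].
  exists x. intros p q H1 H2. apply Hx; [exact H1 | now apply le_INR].
Qed.

(** A single badly approximable point serves every Q. Since A >= 0 and q <= Q, q^-a Q^-A <= q^-(a+A)
    <= q^-(1+1/d), the order of the distance from this point to p/q. *)
Lemma some_unapprox_ge d a A : (1 <= d)%nat -> 0 <= A -> 1 + / INR d <= a + A ->
  some_unapprox d a A.
Proof.
  intros Hd HA HaA. pose proof (INR_ge_1 d Hd) as Hd1.
  destruct (GeometryOfNumbers.badly_approximable d) as [c [x [Hc Hx]]].
  set (eps := Rpower c (/ INR d)).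
  exists eps. split; [apply Rpower_pos |]. intros Q HQ. exists x. intros p q H1 H2.
  pose proof (INR_ge_1 q H1) as Hq1.
  apply Rle_trans with (eps * Rpower (INR q) (- (1 + / INR d))).
  - unfold PsiaA. rewrite Rmult_assoc.
    apply Rmult_le_compat_l; [left; apply Rpower_pos |].
    apply Rle_trans with (Rpower (INR q) (- a) * Rpower (INR q) (- A)).
    + apply Rmult_le_compat_l; [left; apply Rpower_pos |].
      apply Rpower_base_neg; [lra | split; [lra | now apply le_INR]].
    + rewrite <- Rpower_plus. apply Rle_Rpower; lra.
  - apply Rnot_lt_le. intros Hlt. specialize (Hx p q H1).
    fold (dist d x p q) in Hx. revert Hx. apply Rlt_not_le.
    apply Rlt_le_trans with (INR q * (INR q * (eps * Rpower (INR q) (- (1 + / INR d)))) ^ d).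
    + apply Rmult_lt_compat_l; [lra |]. pose proof (dist_ge0 d x p q) as H0.
      assert (Hpow : forall n u v, 0 <= u < v -> u ^ S n < v ^ S n).
      { intros n u v Huv. induction n as [| n IHn]; [simpl; lra |].
        change (u * u ^ S n < v * v ^ S n).
        apply Rmult_le_0_lt_compat; [lra | apply pow_le; lra | lra | exact IHn]. }
      destruct d as [| n]; [lia |]. apply Hpow. nra.
    + right.
      replace (INR q * (eps * Rpower (INR q) (- (1 + / INR d))))
        with (eps * Rpower (INR q) (- 1 / INR d)).
      * rewrite Rpow_mult_distr, <- Rpower_pow_root by (auto; lra).
        replace (eps ^ d) with c.
        -- replace (-1) with (- (1)) by ring. rewrite Rpower_Ropp, Rpower_1 by lra. field. lra.
        -- unfold eps. rewrite <- (Rpower_1 c) at 1 by exact Hc.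
           rewrite (Rpower_pow_root c 1 d Hd Hc). f_equal. f_equal. field. lra.
      * rewrite <- (Rpower_1 (INR q)) at 2 by lra.
        replace (- 1 / INR d) with (1 + - (1 + / INR d)) by (field; lra).
        rewrite Rpower_plus. ring.
Qed.

Lemma all_and_some_approx_f_d d a : (1 <= d)%nat ->
  all_approx d a (f_d d a) /\ some_unapprox d a (f_d d a).
Proof.
  intros Hd. pose proof (INR_ge_1 d Hd) as Hd1. unfold f_d.
  destruct (Rle_dec a 0) as [H0 | H0].
  { rewrite Rabs_left1 by exact H0. change (1 + - a) with (1 - a).
    split; [now apply all_approx_neg | now apply some_unapprox_neg]. }
  destruct (Rle_dec a 1) as [H1 | H1].
  { replace (sum_f_R0 (fun i => a ^ i) (d - 1)) with (geom a d)
      by (destruct d as [| n]; [lia | simpl; now rewrite Nat.sub_0_r]).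
    split; [apply all_approx_01 | apply some_unapprox_01]; auto; lra. }
  destruct (Rle_dec a (1 + / INR d)) as [H2 | H2].
  - split; [apply all_approx_ge1; auto; lra | apply some_unapprox_ge; auto; lra].
  - split; [apply all_approx_zero | apply some_unapprox_ge; auto; lra].
Qed.

(** * From the critical exponent to the three cases *)

Lemma Rpower_unbounded c B : 0 < c ->
  exists Q0, (1 <= Q0)%nat /\ forall Q, (Q0 <= Q)%nat -> B < Rpower (INR Q) c.
Proof.
  intros Hc. set (b := Rabs B + 1).
  assert (Hb : B < b) by (unfold b; pose proof (Rle_abs B); lra).
  assert (Hb0 : 0 < b) by (unfold b; pose proof (Rabs_pos B); lra).
  destruct (INR_unbounded (Rpower b (/ c))) as [n Hn].
  exists (S n). split; [lia |]. intros Q HQ.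
  apply Rlt_le_trans with b; [exact Hb |].
  replace b with (Rpower (Rpower b (/ c)) c).
  - apply Rle_Rpower_l; [lra |]. split; [apply Rpower_pos |].
    assert (INR n <= INR Q) by (apply le_INR; lia). lra.
  - rewrite Rpower_mult, Rinv_l, Rpower_1; lra.
Qed.

(** The ratio of the two sides, (c1/c2) Q^(A2-A1), does not depend on q. *)
Lemma PsiaA_lt c1 c2 a A1 A2 (q Q : nat) :
  0 < c2 -> c1 / c2 < Rpower (INR Q) (A1 - A2) -> PsiaA c1 a A1 q Q < PsiaA c2 a A2 q Q.
Proof.
  intros Hc HQ. unfold PsiaA.
  replace (- A2) with (- A1 + (A1 - A2)) by ring.
  rewrite Rpower_plus.
  pose proof (Rpower_pos (INR q) (- a)). pose proof (Rpower_pos (INR Q) (- A1)).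
  assert (Hlt : c1 < c2 * Rpower (INR Q) (A1 - A2)).
  { apply Rmult_lt_reg_r with (/ c2); [now apply Rinv_0_lt_compat |].
    replace (c2 * Rpower (INR Q) (A1 - A2) * / c2) with (Rpower (INR Q) (A1 - A2)) by (field; lra).
    exact HQ. }
  replace (c2 * Rpower (INR q) (- a) * (Rpower (INR Q) (- A1) * Rpower (INR Q) (A1 - A2)))
    with (c2 * Rpower (INR Q) (A1 - A2) * (Rpower (INR q) (- a) * Rpower (INR Q) (- A1))) by ring.
  rewrite Rmult_assoc. apply Rmult_lt_compat_r; [now apply Rmult_lt_0_compat | exact Hlt].
Qed.

Theorem theorem1 (d : nat) (hd : (1 <= d)%nat) (a A : R) :
  (A < f_d d a ->
     forall eps : R, 0 < eps -> uniformly_approximable_Rd d (PsiaA eps a A)) /\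
  (A > f_d d a ->
     forall kappa : R, 0 < kappa -> ~ uniformly_approximable_Rd d (PsiaA kappa a A)) /\
  (A = f_d d a ->
     exists eps kappa : R, 0 < eps /\ eps <= kappa /\
       uniformly_approximable_Rd d (PsiaA kappa a A) /\
       ~ uniformly_approximable_Rd d (PsiaA eps a A)).
Proof.
  destruct (all_and_some_approx_f_d d a hd) as [[K [HK Hall]] [E [HE Hsome]]].
  set (f := f_d d a) in *.
  assert (unif : forall c A' Q0, (1 <= Q0)%nat ->
    (forall q Q, (Q0 <= Q)%nat -> PsiaA K a f q Q < PsiaA c a A' q Q) ->
    uniformly_approximable_Rd d (PsiaA c a A')).
  { intros c A' Q0 HQ0 Hlt. exists Q0. intros x Q HQ.
    destruct (Hall x Q ltac:(lia)) as [p [q [H1 [H2 Hpq]]]].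
    exists p, q. split; [exact H1 | split; [exact H2 |]].
    eapply Rle_lt_trans; [exact Hpq | now apply Hlt]. }
  assert (not_unif : forall c A' Q0,
    (forall q Q, (Q0 <= Q)%nat -> PsiaA c a A' q Q <= PsiaA E a f q Q) ->
    ~ uniformly_approximable_Rd d (PsiaA c a A')).
  { intros c A' Q0 Hle [Q1 H1].
    (* This [Q] is positive and beyond both thresholds. *)
    set (Q := (1 + Q0 + Q1)%nat). destruct (Hsome Q ltac:(lia)) as [x Hx].
    destruct (H1 x Q ltac:(lia)) as [p [q [Hq1 [Hq2 Hpq]]]].
    apply (Rlt_irrefl (dist d x p q)).
    eapply Rlt_le_trans; [exact Hpq |].
    eapply Rle_trans; [apply Hle; lia | now apply Hx]. }
  split; [| split].
  - intros HA eps Heps.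
    destruct (Rpower_unbounded (f - A) (K / eps) ltac:(lra)) as [Q0 [HQ0 H]].
    apply (unif eps A Q0 HQ0). intros q Q HQ. apply PsiaA_lt; auto.
  - intros HA kappa Hkappa.
    destruct (Rpower_unbounded (A - f) (kappa / E) ltac:(lra)) as [Q0 [HQ0 H]].
    apply (not_unif kappa A Q0). intros q Q HQ. left. apply PsiaA_lt; auto.
  - intros ->. fold f. exists (Rmin E K), (2 * K).
    split; [now apply Rmin_pos | split; [pose proof (Rmin_r E K); lra | split]].
    + apply (unif (2 * K) f 1%nat); [lia |]. intros q Q HQ. apply PsiaA_lt; [lra |].
      rewrite Rminus_diag, Rpower_O by (pose proof (INR_ge_1 Q HQ); lra).
      replace (K / (2 * K)) with (/ 2) by (field; lra). lra.
    + apply (not_unif (Rmin E K) f 0%nat). intros q Q HQ. unfold PsiaA.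
      apply Rmult_le_compat_r; [left; apply Rpower_pos |].
      apply Rmult_le_compat_r; [left; apply Rpower_pos | apply Rmin_l].
Qed.
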